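(* Let $\Bbbk$ be a field of characteristic $2$, let $E$ be a $\Bbbk$-vector space of dimension $n=2m+1\ge 3$, and let $(q_0,q_1)$ be a regular pair of quadratic forms on $E$ with base locus $X=V(q_0,q_1)\subset|E|$. Then $X$ is quasi-split if and only if the pair $(q_0,q_1)$ has a normal form with $r_0=\cdots=r_{n-2}=0$. In particular, such a normal form always exists when $\Bbbk$ is algebraically closed.
   Context: A quadratic form on $E$ is an element $q\in S^2E^\vee$; its polar form $b(v,w)=q(v+w)-q(v)-q(w)$ is alternating. $|E|\cong\mathbb{P}^{2m}$ is the projective space of lines in $E$. The pair $(q_0,q_1)$ is regular if $X=V(q_0,q_1)\subset |E|$ is smooth over $\Bbbk$ and of codimension $2$. A generator of $X$ is a linear subspace contained in $X$ of projective dimension $m-1$, i.e. $|L|$ for an $m$-dimensional vector subspace $L$ on which $q_0$ and $q_1$ both vanish. $X$ is quasi-split if it contains a generator defined over $\Bbbk$. Half-discriminant: fix a volume form on $E$. For a quadratic form $q$ with polar form $b$ and a basis $e_1,\ldots,e_n$ of $E$ of volume $1$, put $\omega=\sum_i \mathrm{Pf}_i\,e_i$, where $\mathrm{Pf}_i$ is the Pfaffian of $(b(e_j,e_k))_{j,k}$ with $i$-th row and column deleted; set $\tfrac12\mathrm{disc}(q):=q(\omega)$. Let $\Delta(t_0,t_1):=\tfrac12\mathrm{disc}(t_0q_0+t_1q_1)=\sum_{i=0}^n a_it_0^{n-i}t_1^i$. Normal form: a basis $(x_0,\ldots,x_m,y_0,\ldots,y_{m-1})$ of $E^\vee$ and elements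 $r_0,\ldots,r_{n-2}\in\Bbbk$ such that $q_0=\sum_{i=0}^m a_{2i}x_i^2+\sum_{i=0}^{m-1}x_{i+1}y_i+\sum_{i=0}^{m-1}r_{2i+1}y_i^2$ and $q_1=\sum_{i=0}^m a_{2i+1}x_i^2+\sum_{i=0}^{m-1}x_iy_i+\sum_{i=0}^{m-1}r_{2i}y_i^2$, with $a_0,\dots,a_n$ the coefficients of $\Delta$. *)

(* Defs.v *)
From HB Require Import structures.
From mathcomp Require Import all_boot all_order all_algebra.
From mathcomp Require Import mpoly.

Set Implicit Arguments.
Unset Strict Implicit.
Unset Printing Implicit Defensive.
Import GRing.Theory.
Local Open Scope ring_scope.

Definition polar (V W : zmodType) (q : V -> W) (v w : V) : W :=
  q (v + w) - q v - q w.

(* On a vector space these functions correspond bijectively to the elements of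
   S^2 E^\vee, over small fields too: the coefficients are q (e_i) and
   polar q e_i e_j. *)
Definition quadratic_form (k : fieldType) (E : vectType k) (q : E -> k) : Prop :=
  (forall (c : k) (v : E), q (c *: v) = c ^+ 2 * q v) /\
  (forall v : E, scalar (polar q v)).

(* q as a homogeneous polynomial in the coordinates dual to e; base change to a
   k-algebra is map_mpoly. *)
Definition qpoly (k : fieldType) (E : vectType k) (n : nat) (e : n.-tuple E)
    (q : E -> k) : {mpoly k[n]} :=
  \sum_(i < n) q (tnth e i) *: 'X_i ^+ 2 +
  \sum_(i < n) \sum_(j < n | (i < j)%N)
     polar q (tnth e i) (tnth e j) *: ('X_i * 'X_j).

Definition jacobian (K : fieldType) (n r : nat) (F : r.-tuple {mpoly K[n]})
    (v : 'I_n -> K) : 'M[K]_(r, n) :=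
  \matrix_(i < r, j < n) ((tnth F i)^`M(j)).@[v].

(* V(q_0, q_1) is smooth over k of codimension 2: at each of its points, with
   values in an arbitrary field extension K of k (k need not be perfect), the
   matrix of partial derivatives has rank 2.  By the Euler relation
   \sum_j v_j * (d_j q) (v) = 2 * q v, this rank at a point of the cone equals
   the rank of the Jacobian matrix in an affine chart of |E|. *)
Definition regular_pair (k : fieldType) (E : vectType k) (n : nat)
    (e : n.-tuple E) (q0 q1 : E -> k) : Prop :=
  forall (K : fieldType) (f : {rmorphism k -> K}) (v : 'I_n -> K),
    let Q0 := map_mpoly f (qpoly e q0) in
    let Q1 := map_mpoly f (qpoly e q1) in
    (exists i, v i != 0) -> Q0.@[v] = 0 -> Q1.@[v] = 0 ->
    \rank (jacobian [tuple Q0; Q1] v) = 2.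

Definition quasi_split (k : fieldType) (E : vectType k) (m : nat)
    (q0 q1 : E -> k) : Prop :=
  exists L : {vspace E},
    \dim L = m /\ (forall v, v \in L -> q0 v = 0 /\ q1 v = 0).

Definition volume_form (k : fieldType) (E : vectType k) (n : nat)
    (vol : n.-tuple E -> k) : Prop :=
  [/\ forall (w : n.-tuple E) (i : 'I_n),
        scalar (fun u : E => vol [tuple if j == i then u else tnth w j | j < n]),
      forall (w : n.-tuple E) (i j : 'I_n),
        i != j -> tnth w i = tnth w j -> vol w = 0
    & exists w : n.-tuple E, vol w != 0].

(* Expansion along the first row: A_(0, j+1) is multiplied by the Pfaffian of A
   with rows and columns 0 and j+1 deleted. *)
Fixpoint pfaffian (R : comNzRingType) (m : nat) : 'M[R]_(m.*2) -> R :=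
  match m return 'M[R]_(m.*2) -> R with
  | 0 => fun _ => 1
  | m'.+1 => fun A : 'M[R]_(m'.*2.+2) =>
      \sum_(j < m'.*2.+1)
         (-1) ^+ j * A ord0 (lift ord0 j) *
         @pfaffian R m' (row' j (col' j (row' ord0 (col' ord0 A))))
  end.

Definition polar_mx (R : comNzRingType) (n : nat) (F : {mpoly R[n]}) : 'M[R]_n :=
  \matrix_(i < n, j < n)
     polar (fun v : 'rV[R]_n => F.@[v ord0]) (delta_mx ord0 i) (delta_mx ord0 j).

Definition half_disc (R : comNzRingType) (m : nat)
    (F : {mpoly R[m.*2.+1]}) : R :=
  F.@[fun i => @pfaffian R m (row' i (col' i (polar_mx F)))].

(* Delta (t_0, t_1), with t_i = 'X_i in {mpoly k[2]}: the half-discriminant,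
   over k[t_0, t_1], of the quadratic form t_0 q_0 + t_1 q_1.  The volume form
   enters as the one with value 1 on e. *)
Definition Delta (k : fieldType) (E : vectType k) (m : nat)
    (e : (m.*2.+1).-tuple E) (q0 q1 : E -> k) : {mpoly k[2]} :=
  half_disc
    ('X_ord0 *: map_mpoly (@mpolyC 2 k) (qpoly e q0) +
     'X_ord_max *: map_mpoly (@mpolyC 2 k) (qpoly e q1)).

(* The coefficient of t_0 ^ (n - i) * t_1 ^ i, where n = 2 * m + 1. *)
Definition Delta_coef (k : fieldType) (E : vectType k) (m : nat)
    (e : (m.*2.+1).-tuple E) (q0 q1 : E -> k) (i : nat) : k :=
  (Delta e q0 q1)@_((U_(ord0) *+ (m.*2.+1 - i) + U_(ord_max) *+ i)%MM).

Definition normal_form (k : fieldType) (E : vectType k) (m : nat)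
    (e : (m.*2.+1).-tuple E) (q0 q1 : E -> k)
    (x : (m.+1).-tuple 'Hom(E, k^o)) (y : m.-tuple 'Hom(E, k^o))
    (r : (m.*2).-tuple k) : Prop :=
  let a := Delta_coef e q0 q1 in
  [/\ basis_of fullv (x ++ y),
      forall v : E, q0 v =
        \sum_(i < m.+1) a i.*2 * (x`_i v) ^+ 2 +
        \sum_(i < m) x`_i.+1 v * y`_i v +
        \sum_(i < m) r`_(i.*2.+1) * (y`_i v) ^+ 2
    & forall v : E, q1 v =
        \sum_(i < m.+1) a i.*2.+1 * (x`_i v) ^+ 2 +
        \sum_(i < m) x`_i v * y`_i v +
        \sum_(i < m) r`_(i.*2) * (y`_i v) ^+ 2].

Definition has_split_normal_form (k : fieldType) (E : vectType k) (m : nat)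
    (e : (m.*2.+1).-tuple E) (q0 q1 : E -> k) : Prop :=
  exists (x : (m.+1).-tuple 'Hom(E, k^o)) (y : m.-tuple 'Hom(E, k^o))
         (r : (m.*2).-tuple k),
    normal_form e q0 q1 x y r /\ (forall i, (i < m.*2)%N -> r`_i = 0).

(* Main.v *)
Require Import Defs.
From HB Require Import structures.
From mathcomp Require Import all_boot all_order all_algebra.
From mathcomp Require Import fieldext.
From mathcomp Require Import mpoly zify ring.

Set Implicit Arguments.
Unset Strict Implicit.
Unset Printing Implicit Defensive.
Import GRing.Theory.
Local Open Scope ring_scope.

(** Write b_0, b_1 for the polar forms of q_0, q_1 and A_0, A_1 for their
    matrices in the basis e.  In characteristic 2 these are symmetric with zero
    diagonal, and so is every combination t_0 A_0 + t_1 A_1.  The size n = 2m+1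
    being odd, the Pfaffians of the principal minors of A_0 + t A_1 form a vector
    w(t) = \sum_i w_i t^i of degree m in the kernel of the pencil.  Comparing
    coefficients,
      w_0 A_0 = 0,    w_(i+1) A_0 = w_i A_1,    w_m A_1 = 0,
    so b_0 and b_1 vanish on the span W of the w_i
    ([kernel_coef0], [kernel_coefS], [kernel_coef_gt], [kernel_mx_iso]).

    Regularity implies that w has no zero on the projective line over any extension
    of k ([regular_pfaffian_vector]).  At a zero, the kernel of the polar form of
    some q_t in the pencil would have dimension at least 3.  On that kernel q_t
    is the square of a linear form after adjoining square roots, so it vanishes
    on a plane, and another form of the pencil vanishes at a point of this plane
    over a quadratic extension: a point of X at which the Jacobian matrix has
    rank less than 2.

    Having no zero, w generates the kernel of the pencil over k[t]
    ([kernel_multiple]), so a nonzero kernel vector has degree at least m.  This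
    forces the m functionals y_i = b_1(w_i, -) and then the m+1 vectors w_i to be
    linearly independent ([pairing_mx_free], [kernel_mx_free]): the pencil
    (b_0, b_1) is a single Kronecker block.  Since W is isotropic,
    q_t (w(t)) is a sum of the squares of the coordinates of w(t) weighted by
    the q_t (w_i), that is, a_(2i) = q_0 (w_i) and a_(2i+1) = q_1 (w_i)
    ([Delta_coef_even], [Delta_coef_odd]).

    Let L be a generator.  If L met W nontrivially, the two polar forms would map the
    intersection, of dimension d > 0, into one space of functionals of dimension
    d, namely those vanishing on L + W; this square pencil has an eigenvector
    over an extension, which is a singular point of X
    ([generator_transversal]).  Hence E is the direct sum of W and L.  The
    coordinates x_i on W along L and the functionals y_i are the normal form: q_j
    vanishes on L, is diagonal on W, and b_0 (w_(i+1), -) = b_1 (w_i, -) = y_i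
    gives the mixed terms ([generator_split_normal_form]).  Conversely the common
    zeros of the x_i contain a generator ([split_normal_form_quasi_split]).

    Over an algebraically closed field, start from vectors u_p with
    y_i (u_p) = [i = p] and look for a generator spanned by
    u_p + \sum_j phi_(j,p) w_j.  Isotropy for b_0 and b_1 is a linear system in
    phi, solved up to adding a Hankel matrix s_(j+p) ([zigzag_solution]).  The
    vanishing of q_0 and q_1 on the basis then reads s + T s = r, with T additive
    and T (c s) = c^2 T s; such equations are solvable over an algebraically
    closed field ([semilinear_onto]). *)

(** * Pfaffians in characteristic 2 *)

(** The Pfaffian of the principal submatrix of a indexed by s, expanded along the
    head of s.  The expansion carries no signs: this is the Pfaffian in
    characteristic 2.  Lists rather than sets of indices are used because the
    vanishing for a repeated index is what yields kernel vectors; [n] is half the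
    length of [s]. *)
Fixpoint pfaffian_seq (R : comNzRingType) (T : eqType) (a : T -> T -> R) (n : nat)
    (s : seq T) : R :=
  match n, s with
  | 0, _ => 1
  | _.+1, [::] => 0
  | n'.+1, x :: s' => \sum_(u <- s') a x u * pfaffian_seq a n' (rem u s')
  end.

Lemma remC (T : eqType) (u v : T) (s : seq T) : rem u (rem v s) = rem v (rem u s).
Proof.
elim: s => [|x s IHs] //=; case: (eqVneq x v) => [->|xv] /=.
  by case: (eqVneq v u) => [->|vu] //=; rewrite eqxx.
by case: (eqVneq x u) => [_|_] //=; rewrite (negPf xv) IHs.
Qed.

Lemma perm_rem_cons (T : eqType) (x u : T) (s : seq T) :
  u \in s -> perm_eq (rem u (x :: s)) (x :: rem u s).
Proof. by move=> us /=; case: eqVneq => [->|//]; exact: perm_to_rem. Qed.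

(** The recursion behind sums over ordered pairs of distinct positions of a list. *)
Lemma sum_rem_pair (R : nmodType) (T : eqType) (G : T -> T -> R) (x : T) (s : seq T) :
  \sum_(u <- x :: s) \sum_(v <- rem u (x :: s)) G u v =
  \sum_(v <- s) G x v + \sum_(u <- s) G u x +
  \sum_(u <- s) \sum_(v <- rem u s) G u v.
Proof.
rewrite big_cons [rem x _]/= eqxx -addrA; congr (_ + _).
rewrite -big_split /= [LHS]big_seq [RHS]big_seq; apply: eq_bigr => u us.
by rewrite -[RHS](big_cons _ _ x (rem u s) predT (G u)); apply/perm_big/perm_rem_cons.
Qed.

Lemma sum_rem_pairC (R : nmodType) (T : eqType) (G : T -> T -> R) (s : seq T) :
  \sum_(u <- s) \sum_(v <- rem u s) G u v =
  \sum_(u <- s) \sum_(v <- rem u s) G v u.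
Proof.
elim: s => [|x s IHs]; first by rewrite !big_nil.
by rewrite !sum_rem_pair IHs [X in X + _ = _]addrC.
Qed.

Lemma eq_pfaffian_seq (R : comNzRingType) (T : eqType) (a b : T -> T -> R) n s :
  (forall x y, a x y = b x y) -> pfaffian_seq a n s = pfaffian_seq b n s.
Proof.
move=> ab; elim: n s => [|n IHn] [|x s] //=.
by apply: eq_bigr => u _; rewrite ab IHn.
Qed.

Section Pfaffian.
Variables (R : comNzRingType) (T : eqType) (a : T -> T -> R).

Hypothesis aC : forall x y, a x y = a y x.

(** By induction on the length, moving elements behind the head does not change
    the value.  Expanding twice, the value at x :: y :: s is a sum over pairs of
    positions that is symmetric in x and y, so the first two elements can be
    exchanged as well, and these moves generate all permutations. *)
Lemma perm_pfaffian_seq n s' s : perm_eq s s' -> size s = n.*2 ->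
  pfaffian_seq a n s = pfaffian_seq a n s'.
Proof.
elim: n s' s => [|n IHn] //.
have pf_behead x s s' : perm_eq s s' -> size s = n.*2.+1 ->
    pfaffian_seq a n.+1 (x :: s) = pfaffian_seq a n.+1 (x :: s').
  move=> ss' sz /=; rewrite (perm_big _ ss') /= [LHS]big_seq [RHS]big_seq.
  apply: eq_bigr => u us'; congr (_ * _); have us : u \in s by rewrite (perm_mem ss').
  apply: IHn; last by rewrite size_rem // sz.
  rewrite -(perm_cons u).
  by rewrite -(permPl (perm_to_rem us)) (permPl ss') perm_to_rem.
have pf_swap x y s : size s = n.*2 -> pfaffian_seq a n.+1 [:: x, y & s] =
    pfaffian_seq a n.+1 [:: y, x & s].
  move=> sz; have E z t : pfaffian_seq a n.+1 [:: z, t & s] = a z t * pfaffian_seq a n s +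
      \sum_(u <- s) a z u * pfaffian_seq a n (t :: rem u s).
    rewrite /= big_cons /= eqxx; congr (_ + _).
    rewrite [LHS]big_seq [RHS]big_seq; apply: eq_bigr => u us; congr (_ * _).
    apply: IHn; first exact: perm_rem_cons.
    by rewrite /= -/(rem u (t :: s)) size_rem ?inE ?us ?orbT.
  rewrite !E aC; congr (_ + _); case: n IHn sz {pf_behead E} => [|n] IHn sz.
    by case: s sz => // _; rewrite !big_nil.
  rewrite /=.
  under eq_bigr => u _ do rewrite big_distrr /=.
  rewrite sum_rem_pairC; rewrite [LHS]big_seq [RHS]big_seq; apply: eq_bigr => u us.
  rewrite big_distrr [LHS]big_seq [RHS]big_seq; apply: eq_bigr => v vs.
  by rewrite mulrCA remC.
move=> [|y s'] [|x s] // ss'; first by move/perm_size: ss'.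
move=> [sz].
case: (eqVneq x y) => [xy|xy].
  by move: ss'; rewrite xy perm_cons => ss'; exact: pf_behead.
have ys : y \in s.
  by have := mem_head y s'; rewrite -(perm_mem ss') inE eq_sym (negPf xy).
have sz' : size (rem y s) = n.*2 by rewrite size_rem // sz.
rewrite (pf_behead x _ (y :: rem y s)) ?perm_to_rem //.
rewrite pf_swap //; apply: pf_behead; last by rewrite /= sz'.
apply/permP => p; move/permP/(_ p): ss'; rewrite /= (permP (perm_to_rem ys) p) /=.
lia.
Qed.
End Pfaffian.

Lemma sum_rem_pair_sym0 (R : nzRingType) (hR : 2%N \in [pchar R]) (T : eqType)
    (G : T -> T -> R) (s : seq T) :
  (forall u v, G u v = G v u) -> \sum_(u <- s) \sum_(v <- rem u s) G u v = 0.
Proof.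
move=> GC; elim: s => [|x s IHs]; first by rewrite big_nil.
rewrite sum_rem_pair IHs addr0.
by under [X in _ + X]eq_bigr => u _ do rewrite GC; rewrite addrr_pchar2.
Qed.

Section PfaffianChar2.
Variables (R : comNzRingType) (hR : 2%N \in [pchar R]).
Variables (T : eqType) (a : T -> T -> R).
Hypothesis aC : forall x y, a x y = a y x.
Hypothesis axx : forall x, a x x = 0.

(** After moving the second copy of x next to the first one, two expansions give a
    sum over ordered pairs of a symmetric summand, in which each term appears
    twice. *)
Lemma pfaffian_seq_repeat n x s :
  x \in s -> size s = n.*2.+1 -> pfaffian_seq a n.+1 (x :: s) = 0.
Proof.
move=> xs sz; have szt : size (rem x s) = n.*2 by rewrite size_rem // sz.
rewrite (perm_pfaffian_seq aC (s' := x :: x :: rem x s)) //; first last.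
- by rewrite /= sz.
- by rewrite perm_cons perm_to_rem.
move: szt; set t := rem x s => szt.
rewrite [LHS]/= big_cons axx mul0r add0r.
case: n szt {sz} => [|n] szt; first by case: t szt => // _; rewrite big_nil.
rewrite big_seq; under eq_bigr => u ut.
  rewrite (perm_pfaffian_seq aC (perm_rem_cons x ut)); last first.
    by rewrite size_rem ?inE ?ut ?orbT //= szt.
  rewrite /= big_distrr /=.
  under eq_bigr => v _ do rewrite mulrA.
over.
rewrite -big_seq.
apply: (@sum_rem_pair_sym0 _ hR _
  (fun u v => a x u * a x v * pfaffian_seq a n (rem v (rem u t)))).
by move=> u v; rewrite remC [a x u * _]mulrC.
Qed.

End PfaffianChar2.

(** Expanding at l and summing over l first leaves the rows of a paired with the
    kernel vector xi. *)
Lemma pfaffian_seq_kernel (R : comNzRingType) (T : finType) (a : T -> T -> R)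
    (xi : T -> R) n s :
  (forall u, \sum_l xi l * a l u = 0) ->
  \sum_l xi l * pfaffian_seq a n.+1 (l :: s) = 0.
Proof.
move=> axi /=; under eq_bigr => l _ do rewrite big_distrr /=.
rewrite exchange_big big1 //= => u _.
by under eq_bigr => l _ do rewrite mulrA; rewrite -big_distrl /= axi mul0r.
Qed.

(** The vector \omega of the half-discriminant: its j-th entry is the Pfaffian of
    a with row and column j deleted. *)
Definition pfaffian_vector (R : comNzRingType) m (a : 'I_m.*2.+1 -> 'I_m.*2.+1 -> R) :=
  fun j => pfaffian_seq a m (rem j (enum 'I_m.*2.+1)).

Section Odd.
Variables (R : comNzRingType) (hR : 2%N \in [pchar R]) (m : nat).
Variables (a : 'I_m.*2.+1 -> 'I_m.*2.+1 -> R).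
Hypothesis aC : forall x y, a x y = a y x.
Hypothesis axx : forall x, a x x = 0.

(** The l-th entry of the product is the expansion along l of the Pfaffian of the
    list formed by l and all the indices, where l is repeated. *)
Lemma pfaffian_vector_kernel l : \sum_j a l j * pfaffian_vector a j = 0.
Proof.
rewrite -[RHS](@pfaffian_seq_repeat R hR _ a aC axx m l (enum 'I_m.*2.+1)) //=.
- by rewrite big_enum.
- by rewrite mem_enum.
- by rewrite size_enum_ord.
Qed.

(** Apply [pfaffian_seq_kernel] to the list s of all indices except i and j.  Only
    l = i and l = j give a list l :: s without repetition, and these two terms are
    the two sides. *)
Lemma pfaffian_vector_unique xi : (forall u, \sum_l xi l * a l u = 0) ->
  forall i j, xi i * pfaffian_vector a j = xi j * pfaffian_vector a i.
Proof.
move=> axi i j; case: (eqVneq i j) => [->//|ij].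
have [n mE] : exists n, m = n.+1.
  by case: m i j ij => [i j|n]; [rewrite !ord1 eqxx|exists n].
pose s := rem i (rem j (enum 'I_m.*2.+1)).
have U := enum_uniq 'I_m.*2.+1; have U' := rem_uniq j U.
have is1 : i \in rem j (enum 'I_m.*2.+1) by rewrite mem_rem_uniq // !inE ij mem_enum.
have js1 : j \in rem i (enum 'I_m.*2.+1).
  by rewrite (mem_rem_uniq _ U) // !inE eq_sym ij mem_enum.
have sz2 : size (rem j (enum 'I_m.*2.+1)) = m.*2.
  by rewrite size_rem ?mem_enum // size_enum_ord.
have sz : size s = n.*2.+1 by rewrite size_rem // sz2 mE.
have pfi : pfaffian_seq a n.+1 (i :: s) = pfaffian_vector a j.
  rewrite -mE; apply/esym/perm_pfaffian_seq => //; exact: perm_to_rem.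
have pfj : pfaffian_seq a n.+1 (j :: s) = pfaffian_vector a i.
  rewrite -mE /s remC; apply/esym/perm_pfaffian_seq => //; first exact: perm_to_rem.
  by rewrite size_rem ?mem_enum // size_enum_ord.
have := pfaffian_seq_kernel n s axi; rewrite (bigD1 i) // (bigD1 j) 1?eq_sym //.
rewrite pfi pfj big1 ?addr0 => [/eqP|l /andP[li lj]].
  by rewrite addr_eq0 (oppr_pchar2 hR) /= addr0 => /eqP.
rewrite pfaffian_seq_repeat ?mulr0 // /s (mem_rem_uniq _ U') inE.
by rewrite (mem_rem_uniq _ U) inE /= lj mem_enum andbT; move: li => /= ->.
Qed.
End Odd.

Section Corank.
Variables (K : fieldType) (hK : 2%N \in [pchar K]) (m : nat).
Variables (a : 'I_m.*2.+1 -> 'I_m.*2.+1 -> K).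
Hypothesis aC : forall x y, a x y = a y x.
Hypothesis axx : forall x, a x x = 0.

(** Take a duplicate-free list t of maximal length with nonzero Pfaffian.  If the
    Pfaffian vector is zero, t has length less than 2m, so at least three indices
    lie outside t, and each of them gives a kernel vector.  These vectors are
    independent because each has a single nonzero entry outside t; the values at
    [h] record this. *)
Lemma pfaffian_vector0_corank : (forall j, pfaffian_vector a j = 0) ->
  exists (h : 'I_3 -> 'I_m.*2.+1) (v : 'I_3 -> 'I_m.*2.+1 -> K),
    (forall p l, \sum_u v p u * a u l = 0) /\
    (forall p q, v p (h q) = (p == q)%:R).
Proof.
move=> pf0.
pose P r := [exists t : (r.*2).-tuple 'I_m.*2.+1, uniq t && (pfaffian_seq a r t != 0)].
have P0 : exists r, P r by exists 0%N; apply/existsP; exists [tuple]; rewrite /= oner_eq0.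
have Pm r : P r -> (r <= m)%N.
  case/existsP=> t /andP[/uniq_leq_size /(_ (fun x _ => mem_enum 'I__ x))].
  by rewrite size_tuple size_enum_ord; lia.
case: (ex_maxnP P0 Pm) => r /[dup] Pr /existsP[t /andP[ut nzt]] rmax.
move: (tval t) (size_tuple t) ut nzt => {}t szt ut nzt.
have Pr1 s : uniq s -> size s = r.+1.*2 -> pfaffian_seq a r.+1 s = 0.
  move=> us sz; apply/eqP/negPn/negP => nz; have /rmax : P r.+1.
    by apply/existsP; exists (tcast sz (in_tuple s)); rewrite val_tcast us nz.
  by rewrite ltnn.
have rm : (r < m)%N.
  rewrite ltn_neqAle Pm ?andbT //.
  apply/eqP => rm; case/negP: nzt; apply/eqP.
  have [j jt] : exists j, j \notin t.
    apply/existsP/contraT; rewrite negb_exists => /forallP tall.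
    have := uniq_leq_size (enum_uniq 'I_m.*2.+1) (fun x _ => negbNE (tall x)).
    by rewrite size_enum_ord szt rm ltnn.
  rewrite -[RHS](pf0 j) /pfaffian_vector {1}rm; apply: perm_pfaffian_seq => //; last first.
    by rewrite szt rm.
  rewrite uniq_perm // ?rem_uniq ?enum_uniq //.
  apply uniq_min_size => //.
    move=> x xt; rewrite mem_rem_uniq ?enum_uniq // !inE mem_enum andbT.
    by apply: contraNneq jt => <-.
  by rewrite size_rem ?mem_enum // size_enum_ord szt rm.
pose o := [seq x <- enum 'I_m.*2.+1 | x \notin t].
have uo : uniq o by rewrite filter_uniq ?enum_uniq.
have szo : (2 < size o)%N.
  have E : count (mem t) (enum 'I_m.*2.+1) = r.*2.
    rewrite -szt -size_filter; apply/perm_size/uniq_perm => // [|x].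
      by rewrite filter_uniq ?enum_uniq.
    by rewrite mem_filter mem_enum andbT.
  have := count_predC (mem t) (enum 'I_m.*2.+1).
  rewrite E size_enum_ord size_filter; set c := count _ _; lia.
have op (p : 'I_3) : (p < size o)%N by exact: leq_trans (ltn_ord p) szo.
pose h (p : 'I_3) := nth ord0 o p.
have ho p : h p \notin t.
  have : h p \in o by rewrite mem_nth.
  by rewrite mem_filter => /andP[].
(* Row l of a times the vector of the Pfaffians of (i :: t) minus u is the
   Pfaffian of l :: i :: t, zero by maximality of t or because l is repeated.
   Dividing by the Pfaffian of t makes the entry at i equal to 1. *)
exists h, (fun p u => if u \in h p :: t
  then pfaffian_seq a r (rem u (h p :: t)) / pfaffian_seq a r t else 0).
split=> [p l|p q].
  apply: (mulIf nzt); rewrite mul0r big_distrl /=.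
  rewrite -[RHS](_ : pfaffian_seq a r.+1 (l :: h p :: t) = 0); last first.
    case lt: (l \in h p :: t); first by apply: pfaffian_seq_repeat; rewrite //= szt.
    by apply: Pr1; rewrite /= ?szt //= lt /= ho.
  rewrite [RHS]/= [RHS]big_uniq /=; last by rewrite ho ut.
  rewrite [RHS]big_mkcond; apply: eq_bigr => u _; case: ifP => _; last by rewrite !mul0r.
  by rewrite mulrAC divfK // mulrC aC.
have hI : (h q == h p) = (q == p).
  by rewrite nth_uniq.
rewrite inE (negPf (ho q)) orbF hI eq_sym; case: eqVneq => // ->.
by rewrite /= eqxx divff.
Qed.
End Corank.

(** * Pfaffians of pencils *)
Section Pencil.
Variables (k R : comNzRingType) (f : {rmorphism k -> R}) (t0 t1 : R).

(** The form of degree n in t_0, t_1 attached to a polynomial of degree at most n.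
    The values (1, x) and (0, 1) evaluate p at x and extract its coefficient of
    degree n; the two variables of a polynomial ring homogenize it. *)
Definition homogenize n (p : {poly k}) : R :=
  \sum_(i < n.+1) f p`_i * (t0 ^+ (n - i) * t1 ^+ i).

Lemma homogenize_sum n I (r : seq I) (P : pred I) (p : I -> {poly k}) :
  homogenize n (\sum_(i <- r | P i) p i) = \sum_(i <- r | P i) homogenize n (p i).
Proof.
rewrite /homogenize exchange_big /=; apply: eq_bigr => i _.
by rewrite coef_sum rmorph_sum big_distrl.
Qed.

Lemma homogenize_mul n (p : {poly k}) (al be : k) : (size p <= n.+1)%N ->
  homogenize n.+1 ((al%:P + be%:P * 'X) * p) = (t0 * f al + t1 * f be) * homogenize n p.
Proof.
move=> sp; rewrite /homogenize.
have E i : ((al%:P + be%:P * 'X) * p)`_i = al * p`_i + be * ('X * p)`_i.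
  by rewrite mulrDl coefD coefCM -mulrA coefCM.
under eq_bigr => i _ do rewrite E rmorphD mulrDl !rmorphM.
rewrite big_split mulrDl /=; congr (_ + _).
  rewrite big_ord_recr /= (nth_default _ sp) rmorph0 mulr0 mul0r addr0.
  rewrite big_distrr /=; apply: eq_bigr => i _.
  by rewrite subSn 1?leq_ord // exprS; ring.
rewrite big_ord_recl coefXM rmorph0 mulr0 mul0r add0r big_distrr /=.
by apply: eq_bigr => i _; rewrite coefXM /= subSS exprS; ring.
Qed.

Variables (T : eqType) (al be : T -> T -> k).
Definition pencil x y : {poly k} := (al x y)%:P + (be x y)%:P * 'X.

Lemma size_pfaffian_pencil n s : (size (pfaffian_seq pencil n s) <= n.+1)%N.
Proof.
elim: n s => [|n IHn] [|x s] /=; rewrite ?size_poly1 ?size_poly0 //.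
apply: (leq_trans (size_sum _ _ _)); apply/bigmax_leqP_seq => u _ _.
apply: (leq_trans (size_polyMleq _ _)).
have : (size (pencil x u) <= 2)%N.
  apply: (leq_trans (size_polyD _ _)); rewrite geq_max.
  rewrite (leq_trans (size_polyC_leq1 _)) //=.
  by rewrite mul_polyC (leq_trans (size_scale_leq _ _)) // size_polyX.
have := IHn (rem u s); lia.
Qed.

(** A Pfaffian of size 2n is homogeneous of degree n in the entries, so the pencil
    with parameter (t_0, t_1) in any k-algebra is controlled by the one over
    k[t]. *)
Lemma pfaffian_seq_pencil n s :
  pfaffian_seq (fun x y => t0 * f (al x y) + t1 * f (be x y)) n s =
  homogenize n (pfaffian_seq pencil n s).
Proof.
elim: n s => [|n IHn] s.
  rewrite /= /homogenize big_ord_recl big_ord0 coefC eqxx rmorph1 !expr0.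
  by rewrite !mulr1 addr0.
case: s => [|x s] /=.
  by rewrite /homogenize big1 // => i _; rewrite coef0 rmorph0 mul0r.
rewrite homogenize_sum; apply: eq_bigr => u _.
by rewrite homogenize_mul ?size_pfaffian_pencil // IHn.
Qed.
End Pencil.

(** The two expansions along the first row agree since -1 = 1; the index sets left
    after deleting two indices agree up to order. *)
Lemma pfaffianE (R : comNzRingType) (hR : 2%N \in [pchar R]) (T : eqType)
    (a : T -> T -> R) (aC : forall x y, a x y = a y x) m (g : 'I_m.*2 -> T) :
  injective g -> pfaffian (\matrix_(i, j) a (g i) (g j)) = pfaffian_seq a m (codom g).
Proof.
elim: m g => [|m IHm] g gI //.
have Ec : codom g = g ord0 :: [seq g (lift ord0 i) | i <- enum 'I_m.*2.+1].
  by rewrite codomE (enum_ordSl m.*2.+1) /= -map_comp.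
rewrite Ec /= big_map big_enum /=; apply: eq_bigr => j _.
rewrite mxE -signr_odd /= -[X in X ^+ _](oppr_pchar2 hR) opprK expr1n mul1r.
congr (_ * _); pose g' i := g (lift ord0 (lift j i)).
have gI' : injective g' by move=> x y /gI/lift_inj/lift_inj.
have gI0 : injective (fun i => g (lift ord0 i)) by move=> x y /gI/lift_inj.
have U : uniq [seq g (lift ord0 i) | i <- enum 'I_m.*2.+1].
  by rewrite map_inj_uniq ?enum_uniq.
transitivity (pfaffian (\matrix_(i, j) a (g' i) (g' j))).
  by congr pfaffian; apply/matrixP => x y; rewrite !mxE.
rewrite IHm //; apply: perm_pfaffian_seq => //; last by rewrite size_codom card_ord.
apply: uniq_perm; first exact/injectiveP.
  by rewrite rem_uniq.
move=> x; rewrite (mem_rem_uniq _ U) inE /=.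
apply/codomP/andP => [[i ->]|[/= xj /mapP[i _ xi]]].
  rewrite (map_f (fun i => g (lift ord0 i))) ?mem_enum //; split=> //.
  by rewrite (inj_eq gI0) eq_sym neq_lift.
case: (unliftP j i) xi => [i' ->|->] xi; first by exists i'.
by rewrite xi eqxx in xj.
Qed.

Lemma pfaffian_minor (R : comNzRingType) (hR : 2%N \in [pchar R]) m
    (A : 'M[R]_m.*2.+1) (AC : forall x y, A x y = A y x) i :
  pfaffian (row' i (col' i A)) = pfaffian_vector (fun x y => A x y) i.
Proof.
transitivity (pfaffian (\matrix_(x, y) A (lift i x) (lift i y))).
  by congr pfaffian; apply/matrixP => x y; rewrite !mxE.
rewrite (pfaffianE hR (a := fun x y => A x y)) //; last exact: lift_inj.
apply: perm_pfaffian_seq => //; last by rewrite size_codom card_ord.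
apply: uniq_perm; first exact/injectiveP/lift_inj.
  by rewrite rem_uniq // enum_uniq.
move=> x; rewrite (mem_rem_uniq _ (enum_uniq _)) inE /= mem_enum andbT.
apply/codomP/idP => [[y ->]|]; first by rewrite eq_sym neq_lift.
by case: (unliftP i x) => [y -> _|->]; [exists y|rewrite eqxx].
Qed.

(** * Quadratic forms in coordinates *)
Section Bil.
Variables (R : comNzRingType) (n : nat) (A : 'M[R]_n).
Definition bil (u v : 'rV[R]_n) : R := (u *m A *m v^T) 0 0.

Lemma bilDl u u' v : bil (u + u') v = bil u v + bil u' v.
Proof. by rewrite /bil !mulmxDl mxE. Qed.

Lemma bilZl c u v : bil (c *: u) v = c * bil u v.
Proof. by rewrite /bil -!scalemxAl mxE. Qed.

Lemma bilDr u v v' : bil u (v + v') = bil u v + bil u v'.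
Proof. by rewrite /bil linearD mulmxDr mxE. Qed.

Lemma bil_suml I r (P : pred I) (z : I -> R) (u : I -> 'rV[R]_n) v :
  bil (\sum_(i <- r | P i) z i *: u i) v = \sum_(i <- r | P i) z i * bil (u i) v.
Proof.
by rewrite /bil !mulmx_suml summxE; apply: eq_bigr => i _; rewrite -!scalemxAl mxE.
Qed.

Hypothesis AC : A^T = A.

Lemma bilC u v : bil u v = bil v u.
Proof. by rewrite /bil -[RHS]trace_mx11 -mxtrace_tr !trmx_mul trmxK AC mulmxA trace_mx11. Qed.

Lemma bil_sumr I r (P : pred I) (z : I -> R) (u : I -> 'rV[R]_n) v :
  bil v (\sum_(i <- r | P i) z i *: u i) = \sum_(i <- r | P i) z i * bil v (u i).
Proof. by rewrite bilC bil_suml; apply: eq_bigr => i _; rewrite bilC. Qed.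
End Bil.

Section QuadForm.
Variables (R : comNzRingType) (n : nat).

(** The quadratic form with diagonal coefficients d and polar matrix A. *)
Definition qf (d : 'rV[R]_n) (A : 'M[R]_n) (v : 'rV[R]_n) : R :=
  \sum_i d 0 i * v 0 i ^+ 2 + \sum_(i < n) \sum_(j < n | (i < j)%N) A i j * (v 0 i * v 0 j).

Hypothesis hR : 2%N \in [pchar R].
Variables (d : 'rV[R]_n) (A : 'M[R]_n).
Hypothesis AC : A^T = A.
Hypothesis Axx : forall i, A i i = 0.

Lemma qf0 : qf d A 0 = 0.
Proof.
rewrite /qf big1 => [|i _]; last by rewrite mxE expr0n mulr0.
by rewrite add0r big1 // => i _; rewrite big1 // => j _; rewrite mxE mul0r mulr0.
Qed.

Lemma qfZ c v : qf d A (c *: v) = c ^+ 2 * qf d A v.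
Proof.
rewrite /qf mulrDr !big_distrr /=; congr (_ + _); apply: eq_bigr => i _.
  by rewrite mxE; ring.
by rewrite big_distrr; apply: eq_bigr => j _; rewrite !mxE /=; ring.
Qed.

Lemma bil_triangular u v : bil A u v =
    \sum_(i < n) \sum_(j < n | (i < j)%N) A i j * (u 0 i * v 0 j + v 0 i * u 0 j).
Proof.
have -> : bil A u v = \sum_i \sum_j A i j * (u 0 i * v 0 j).
  rewrite /bil mxE exchange_big; apply: eq_bigr => j _ /=.
  by rewrite !mxE big_distrl; apply: eq_bigr => i _ /=; ring.
under [RHS]eq_bigr => i _ do
  (under eq_bigr => j _ do rewrite mulrDr; rewrite big_split /=).
rewrite big_split /= [X in _ = _ + X](exchange_big_dep predT) //= -big_split /=.
apply: eq_bigr => i _; rewrite (bigD1 i) //= Axx mul0r add0r.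
rewrite (bigID (fun j : 'I_n => (i < j)%N)) /=; congr (_ + _).
  by apply: eq_bigl => j; rewrite neq_ltn; case: ltngtP.
apply: eq_big => [j|j _]; first by rewrite -(inj_eq val_inj); case: ltngtP.
by rewrite -{1}AC mxE [v _ _ * _]mulrC.
Qed.

Lemma qfD u v : qf d A (u + v) = qf d A u + qf d A v + bil A u v.
Proof.
have Ed : \sum_i d 0 i * (u + v) 0 i ^+ 2 =
    \sum_i d 0 i * u 0 i ^+ 2 + \sum_i d 0 i * v 0 i ^+ 2.
  rewrite -big_split /=; apply: eq_bigr => i _; rewrite mxE sqrrD -mulr_natr.
  by rewrite [2%:R](pcharf0 hR) mulr0 addr0 mulrDr.
have Ec : \sum_(i < n) \sum_(j < n | (i < j)%N) A i j * ((u + v) 0 i * (u + v) 0 j) =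
    \sum_(i < n) \sum_(j < n | (i < j)%N) A i j * (u 0 i * u 0 j) +
    \sum_(i < n) \sum_(j < n | (i < j)%N) A i j * (v 0 i * v 0 j) +
    bil A u v.
  rewrite bil_triangular -!big_split /=; apply: eq_bigr => i _; rewrite -!big_split /=.
  by apply: eq_bigr => j _; rewrite !mxE; ring.
by rewrite /qf Ed Ec; ring.
Qed.

(** Expand q (u + u) = q 0 = 0. *)
Lemma bilxx u : bil A u u = 0.
Proof.
have := qfD u u; have x2 (v : 'rV[R]_n) : v + v = 0.
  by rewrite -mulr2n -scaler_nat (pcharf0 hR) scale0r.
by rewrite x2 qf0 (addrr_pchar2 hR) add0r.
Qed.

Lemma qf_sum I (r : seq I) (z : I -> R) (u : I -> 'rV[R]_n) :
  (forall i j, bil A (u i) (u j) = 0) ->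
  qf d A (\sum_(i <- r) z i *: u i) = \sum_(i <- r) z i ^+ 2 * qf d A (u i).
Proof.
move=> u0; elim: r => [|i r IHr]; first by rewrite !big_nil qf0.
rewrite !big_cons qfD qfZ IHr [X in _ + X](_ : _ = 0) ?addr0 //.
rewrite bil_sumr // big1 // => j _.
by rewrite bilZl u0 !mulr0.
Qed.

Lemma qf_mul p (z : 'rV[R]_p) (U : 'M[R]_(p, n)) : U *m A *m U^T = 0 ->
  qf d A (z *m U) = \sum_i z 0 i ^+ 2 * qf d A (row i U).
Proof.
move=> U0; rewrite mulmx_sum_row qf_sum // => i j.
transitivity ((U *m A *m U^T) i j); last by rewrite U0 mxE.
by rewrite /bil -row_mul !mxE; apply: eq_bigr => l _; rewrite !mxE.
Qed.

End QuadForm.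

Lemma qf_map (R S : comNzRingType) (f : {rmorphism R -> S}) n (d : 'rV[R]_n) A v :
  qf (map_mx f d) (map_mx f A) (map_mx f v) = f (qf d A v).
Proof.
rewrite /qf rmorphD !rmorph_sum; congr (_ + _); apply: eq_bigr => i _.
  by rewrite !mxE rmorphM rmorphXn.
by rewrite rmorph_sum; apply: eq_bigr => j _; rewrite !mxE !rmorphM.
Qed.

(** * Field extensions *)

(** A root of p in some extension exists as soon as p has an irreducible factor,
    which cannot be found effectively over an arbitrary field.  Its existence is
    therefore stated in doubly negated form, which suffices for proofs by
    contradiction.  If p has no root in any extension, then neither has a proper
    factor of p; by induction p has no nonconstant proper factor, so p is
    irreducible and acquires a root in the field it defines. *)
Lemma root_extension (F : fieldType) (p : {poly F}) : (1 < size p)%N ->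
  (forall (K : fieldType) (f : {rmorphism F -> K}) x, ~ root (map_poly f p) x) ->
  False.
Proof.
have [n] := ubnP (size p); elim: n p => // n IHn p pn p1 noroot.
have irr : irreducible_poly p.
  split=> // q q1 qp; apply/negPn/negP => qNp.
  have p0 : p != 0 by rewrite -size_poly_gt0 ltnW.
  have qltp : (size q < size p)%N.
    by rewrite ltn_neqAle dvdp_leq // dvdp_size_eqp // qNp.
  have q_gt1 : (1 < size q)%N.
    rewrite ltn_neqAle eq_sym q1 size_poly_gt0.
    by apply: contraNneq p0 => q0; move: qp; rewrite q0 dvd0p.
  apply: (IHn q _ q_gt1) => [|K f x rq]; first exact: leq_trans qltp _.
  by apply: (noroot K f x); case/dvdpP: qp => c ->; rewrite rmorphM rootM rq orbT.
have [L _ [z rz _]] := irredp_FAdjoin irr.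
exact: noroot L (in_alg L) z rz.
Qed.

Lemma sqrt_extension (F : fieldType) n (b : 'I_n -> F) :
  (forall (K : fieldType) (f : {rmorphism F -> K}) (s : 'I_n -> K),
      ~ forall i, s i ^+ 2 = f (b i)) -> False.
Proof.
elim: n F b => [|n IHn] F b noext.
  by apply: (noext F idfun (fun _ => 0)) => -[].
apply: (IHn F (fun i => b (lift ord0 i))) => K f s sE.
apply: (@root_extension K ('X^2 - (f (b ord0))%:P)) => [|L g x].
  by rewrite size_XnsubC.
rewrite rmorphB /= map_polyXn map_polyC /root !hornerE subr_eq0 => /eqP xE.
apply: (noext L (g \o f : {rmorphism _ -> _})
  (fun i => if unlift ord0 i is Some j then g (s j) else x)) => i.
by case: unliftP => [j ->|->] /=; rewrite -?xE // -sE rmorphXn.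
Qed.

Lemma quadratic_extension (F : fieldType) (a b c : F) : c != 0 ->
  (forall (K : fieldType) (f : {rmorphism F -> K}) x,
      f a + x * f b + x ^+ 2 * f c <> 0) -> False.
Proof.
move=> c0 noroot; apply: (@root_extension F ((c%:P * 'X + b%:P) * 'X + a%:P)) => [|K f x].
  have s1 : size (c%:P * 'X + b%:P) = 2%N.
    by rewrite size_MXaddC polyC_eq0 (negPf c0) size_polyC c0.
  by rewrite size_MXaddC -size_poly_eq0 s1.
rewrite /root !(rmorphD, rmorphM) /= !map_polyC map_polyX !hornerE /= => /eqP rx.
by apply: (noroot K f x); rewrite -[RHS]rx; ring.
Qed.

Lemma row_free_injP (F : fieldType) p q (M : 'M[F]_(p, q)) :
  (forall z : 'rV_p, z *m M = 0 -> z = 0) -> row_free M.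
Proof.
move=> M0; rewrite -kermx_eq0; apply/eqP/row_matrixP => i.
by rewrite row0; apply: M0; apply/sub_kermxP/row_sub.
Qed.

(** * Zeros of the Pfaffian vector are singular points *)
Lemma submx_of_rank (F : fieldType) p n r (M : 'M[F]_(p, n)) : (r <= \rank M)%N ->
  exists C : 'M[F]_(r, n), row_free C && (C <= M)%MS.
Proof.
move=> rM; exists ((pid_mx r : 'M_(r, \rank M)) *m row_base M).
rewrite /row_free mxrankMfree ?row_base_free // rank_pid_mx // eqxx /=.
by rewrite (submx_trans (submxMl _ _)) // eq_row_base.
Qed.

Lemma supmx_of_rank (F : fieldType) p n r (M : 'M[F]_(p, n)) : (\rank M <= r)%N ->
  exists B : 'M[F]_(r, n), (M <= B)%MS.
Proof.
move=> Mr; exists ((pid_mx (\rank M) : 'M_(r, n)) *m row_ebase M).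
rewrite -{1}(eq_row_base M) /row_base.
rewrite -(pid_mx_id _ _ _ Mr) -mulmxA; exact: submxMl.
Qed.

Lemma map_mx_compE (F K L : comNzRingType) (f : {rmorphism F -> K}) (g : {rmorphism K -> L})
  p n (M : 'M[F]_(p, n)) : map_mx (g \o f) M = map_mx g (map_mx f M).
Proof. by apply/matrixP => i j; rewrite !mxE. Qed.

Section SingularPoint.
Variables (K : fieldType) (hK : 2%N \in [pchar K]) (n : nat).
Variables (d d' : 'rV[K]_n) (A A' : 'M[K]_n).
Hypotheses (AC : A^T = A) (Axx : forall i, A i i = 0).
Hypotheses (AC' : A'^T = A') (Axx' : forall i, A' i i = 0).

(** The rows of V lie in the kernel of A, so the form (d, A) is additive on their
    span: at the combination with coefficients z it is (\sum_i z_i s_i)^2, for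
    square roots s_i of its values at the rows.  It vanishes on the plane \sum_i z_i s_i = 0, and
    (d', A') restricted to a plane has a zero after a quadratic extension. *)
Lemma corank3_singular_point (V : 'M[K]_(3, n)) : row_free V -> V *m A = 0 ->
  (forall (L : fieldType) (f : {rmorphism K -> L}) (v : 'rV[L]_n), v != 0 ->
     qf (map_mx f d) (map_mx f A) v = 0 -> qf (map_mx f d') (map_mx f A') v = 0 ->
     v *m map_mx f A = 0 -> False) -> False.
Proof.
move=> Vfree VA nosing.
apply: (@sqrt_extension K 3 (fun i => qf d A (row i V))) => L f s sE.
have hL : 2%N \in [pchar L] by exact: (rmorph_pchar f hK).
pose S : 'cV[L]_3 := \col_i s i.
(* The rows of U span the plane on which the first form vanishes. *)
have [|C /andP[Cfree CS]] := @submx_of_rank L _ _ 2 (kermx S).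
  by rewrite mxrank_ker; have := rank_leq_col S; lia.
pose U := C *m map_mx f V.
have Ufree : row_free U by rewrite /row_free /U mxrankMfree ?row_free_map.
have UA : U *m map_mx f A = 0 by rewrite -mulmxA -map_mxM VA map_mx0 mulmx0.
have fAC B : B^T = B -> (map_mx f B)^T = map_mx f B by move=> BC; rewrite map_trmx BC.
have fAxx (B : 'M_n) : (forall i, B i i = 0) -> forall i, map_mx f B i i = 0.
  by move=> B0 i; rewrite mxE B0 rmorph0.
have qU z : qf (map_mx f d) (map_mx f A) (z *m U) = 0.
  rewrite mulmxA qf_mul ?fAC //; [|exact: fAxx|]; last by rewrite -map_mxM VA map_mx0 mul0mx.
  have -> : \sum_i (z *m C) 0 i ^+ 2 * qf (map_mx f d) (map_mx f A) (row i (map_mx f V))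
      = (\sum_i (z *m C) 0 i * s i) ^+ 2.
    rewrite -(pFrobenius_autE hL) rmorph_sum /=; apply: eq_bigr => i _.
    by rewrite pFrobenius_autE exprMn sE -qf_map map_row.
  have -> : \sum_i (z *m C) 0 i * s i = (z *m C *m S) 0 0.
    by rewrite [RHS]mxE; apply: eq_bigr => i _; rewrite [S _ _]mxE.
  by rewrite -mulmxA (sub_kermxP CS) mulmx0 mxE expr0n.
have nzU (M : fieldType) (g : {rmorphism L -> M}) (z : 'rV_2) : z != 0 -> z *m map_mx g U != 0.
  by rewrite mulmx_free_eq0 ?row_free_map.
(* Either w is a zero of the second form, or u + x w is one for some x. *)
pose q1 := qf (map_mx f d') (map_mx f A').
pose u := row 0 U; pose w := row 1 U.
have [q1w|q1w] := eqVneq (q1 w) 0.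
  apply: (nosing L f w _ _ q1w).
  - rewrite /w rowE mulmx_free_eq0 //; apply/eqP => /matrixP/(_ 0 1)/eqP.
    by rewrite !mxE eqxx oner_eq0.
  - by rewrite /w rowE qU.
  - by rewrite /w rowE -mulmxA UA mulmx0.
apply: (@quadratic_extension L (q1 u) (bil (map_mx f A') u w) (q1 w) q1w) => M g x rx.
have hM : 2%N \in [pchar M] by exact: (rmorph_pchar g hL).
pose z : 'rV[M]_2 := \row_i if i == 0 then 1 else x.
have zU : z *m map_mx g U = map_mx g u + x *: map_mx g w.
  rewrite mulmx_sum_row !big_ord_recl big_ord0 addr0 !mxE /= scale1r !map_row.
  by congr (_ + _ *: row _ _); apply/val_inj.
apply: (nosing M (g \o f : {rmorphism _ -> _}) (z *m map_mx g U)).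
- by apply: nzU; apply/eqP => /matrixP/(_ 0 0)/eqP; rewrite !mxE oner_eq0.
- rewrite !map_mx_compE qf_mul //.
  + rewrite big1 // => i _; rewrite -map_row qf_map rowE qU rmorph0 mulr0 //.
  + by rewrite !map_trmx AC.
  + by move=> i; rewrite !mxE Axx !rmorph0.
  + by rewrite -map_mxM UA map_mx0 mul0mx.
- rewrite zU !map_mx_compE qfD //.
  + rewrite qfZ !qf_map /bil linearZ /= -scalemxAr [X in _ + X]mxE map_trmx -!map_mxM.
    by rewrite [X in _ + _ * X]mxE addrAC.
  + by rewrite !map_trmx AC'.
  + by move=> i; rewrite !mxE Axx' !rmorph0.
- by rewrite map_mx_compE -mulmxA -map_mxM UA map_mx0 mulmx0.
Qed.
End SingularPoint.

(** Regularity for a pair given by coefficients: at a common zero v, the rows of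
    the Jacobian matrix are v A_0 and v A_1. *)
Definition regular_forms (k : fieldType) n (d0 d1 : 'rV[k]_n) (A0 A1 : 'M[k]_n) :=
  forall (K : fieldType) (f : {rmorphism k -> K}) (v : 'rV[K]_n), v != 0 ->
    qf (map_mx f d0) (map_mx f A0) v = 0 -> qf (map_mx f d1) (map_mx f A1) v = 0 ->
    forall t0 t1, t0 *: (v *m map_mx f A0) + t1 *: (v *m map_mx f A1) = 0 ->
    t0 = 0 /\ t1 = 0.

Section Regular.
Variables (k : fieldType) (hk : 2%N \in [pchar k]) (m : nat).
Notation n := (m.*2.+1).
Variables (d0 d1 : 'rV[k]_n) (A0 A1 : 'M[k]_n).
Hypotheses (AC0 : A0^T = A0) (Axx0 : forall i, A0 i i = 0).
Hypotheses (AC1 : A1^T = A1) (Axx1 : forall i, A1 i i = 0).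
Hypothesis reg : regular_forms d0 d1 A0 A1.

(** At a zero of the Pfaffian vector, [corank3_singular_point] applies to the
    member of the pencil with parameter (t_0, t_1) and to one of the two given
    forms, chosen so that their common zeros are those of the whole pencil. *)
Lemma regular_pfaffian_vector (K : fieldType) (f : {rmorphism k -> K}) t0 t1 :
  (t0 != 0) || (t1 != 0) ->
  exists j, pfaffian_vector (fun x y => t0 * f (A0 x y) + t1 * f (A1 x y)) j != 0.
Proof.
move=> t01; apply/existsP; apply: contraT; rewrite negb_exists => /forallP pf0.
have hK : 2%N \in [pchar K] by exact: (rmorph_pchar f hk).
set a := fun _ _ => _ in pf0.
have aC x y : a x y = a y x by rewrite /a -{1}AC0 -{1}AC1 !mxE.
have axx x : a x x = 0 by rewrite /a Axx0 Axx1 rmorph0 !mulr0 addr0.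
have [|h [v [va vh]]] := pfaffian_vector0_corank hK aC axx.
  by move=> j; apply/eqP/negPn.
pose V := \matrix_(p, j) v p j.
pose At := t0 *: map_mx f A0 + t1 *: map_mx f A1.
pose dt := t0 *: map_mx f d0 + t1 *: map_mx f d1.
have VA : V *m At = 0.
  apply/matrixP => p l; rewrite !mxE -[RHS](va p l); apply: eq_bigr => u _.
  by rewrite !mxE.
have Vfree : row_free V.
  apply/row_freeP; exists (\matrix_(j, p) (j == h p)%:R).
  apply/matrixP => p q; rewrite !mxE -vh (bigD1 (h q)) //= big1 ?addr0.
    by rewrite !mxE eqxx mulr1.
  by move=> j /negPf jh; rewrite !mxE jh mulr0.
have AtC : At^T = At by rewrite /At linearD !linearZ /= !map_trmx AC0 AC1.
have Atxx i : At i i = 0 by rewrite !mxE Axx0 Axx1 rmorph0 !mulr0 addr0.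
have qt (L : fieldType) (g : {rmorphism K -> L}) v0 : qf (map_mx g dt) (map_mx g At) v0 =
   g t0 * qf (map_mx (g \o f) d0) (map_mx (g \o f) A0) v0 +
   g t1 * qf (map_mx (g \o f) d1) (map_mx (g \o f) A1) v0.
  rewrite /qf !mulrDr addrACA; congr (_ + _).
    rewrite !big_distrr -big_split; apply: eq_bigr => i _.
    by rewrite !mxE /= rmorphD !rmorphM; ring.
  rewrite !big_distrr -big_split; apply: eq_bigr => i _ /=.
  rewrite !big_distrr -big_split; apply: eq_bigr => j _ /=.
  by rewrite !mxE /= rmorphD !rmorphM; ring.
have nosing (L : fieldType) (g : {rmorphism K -> L}) (w : 'rV[L]_n) : w != 0 ->
    qf (map_mx (g \o f) d0) (map_mx (g \o f) A0) w = 0 ->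
    qf (map_mx (g \o f) d1) (map_mx (g \o f) A1) w = 0 ->
    w *m map_mx g At = 0 -> False.
  move=> w0 q0 q1 wA; have := @reg _ (g \o f : {rmorphism _ -> _}) w w0 q0 q1 (g t0) (g t1).
  case=> [|/eqP + /eqP]; last by rewrite !fmorph_eq0; case/orP: t01 => /negPf->.
  rewrite -[RHS]wA !scalemxAr -mulmxDr map_mxD !map_mxZ !map_mx_compE.
  by congr (_ *m _); apply/matrixP => i j; rewrite !mxE.
suff : False by [].
case: (eqVneq t0 0) t01 => [t00|t0N] /= t1N.
  apply: (@corank3_singular_point K hK _ dt (map_mx f d0) At (map_mx f A0)
    AtC Atxx _ _ V Vfree VA).
  - by rewrite map_trmx AC0.
  - by move=> i; rewrite mxE Axx0 rmorph0.
  move=> L g w w0 wt; rewrite -!map_mx_compE => w1; apply: (nosing L g w w0) => //.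
  move/eqP: wt; rewrite qt w1 mulr0 add0r mulf_eq0 fmorph_eq0 (negPf t1N) /=.
  by move/eqP.
apply: (@corank3_singular_point K hK _ dt (map_mx f d1) At (map_mx f A1)
    AtC Atxx _ _ V Vfree VA).
- by rewrite map_trmx AC1.
- by move=> i; rewrite mxE Axx1 rmorph0.
move=> L g w w0 wt; rewrite -!map_mx_compE => w1; apply: (nosing L g w w0) => //.
move/eqP: wt; rewrite qt w1 mulr0 addr0 mulf_eq0 fmorph_eq0 (negPf t0N) /=.
by move/eqP.
Qed.
End Regular.

(** * The Kronecker form of the pencil of polar forms *)
Lemma common_divisor (k : fieldType) n (p : 'I_n -> {poly k}) :
  exists u : 'I_n -> {poly k}, forall j, \sum_i u i * p i %| p j.
Proof.
elim: n p => [|n IHn] p; first by exists (fun _ => 0) => -[].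
have [u Hu] := IHn (fun i => p (lift ord0 i)).
set g := \sum_i _ in Hu; have [[a b] /= ab] := Bezoutp (p ord0) g.
exists (fun i => if unlift ord0 i is Some j then b * u j else a) => j.
rewrite big_ord_recl unlift_none.
under eq_bigr => i _ do rewrite liftK -mulrA.
rewrite -big_distrr /= -/g (eqp_dvdl _ ab).
case: (unliftP ord0 j) => [i ->|->]; last exact: dvdp_gcdl.
exact: dvdp_trans (dvdp_gcdr _ _) (Hu i).
Qed.

Section Kronecker.
Variables (k : fieldType) (hk : 2%N \in [pchar k]) (m : nat).
Notation n := (m.*2.+1).
Variables (d0 d1 : 'rV[k]_n) (A0 A1 : 'M[k]_n).
Hypotheses (AC0 : A0^T = A0) (Axx0 : forall i, A0 i i = 0).
Hypotheses (AC1 : A1^T = A1) (Axx1 : forall i, A1 i i = 0).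
Hypothesis reg : regular_forms d0 d1 A0 A1.
Hypothesis m0 : (0 < m)%N.

Let a := pencil (fun x y => A0 x y) (fun x y => A1 x y).
(** The vector w(t) in the kernel of A_0 + t A_1, and its coefficients w_i. *)
Definition kernel_poly (i : 'I_n) : {poly k} := pfaffian_vector a i.
Definition kernel_coef (i : nat) : 'rV[k]_n := \row_j (kernel_poly j)`_i.

Let hP : 2%N \in [pchar {poly k}].
Proof. exact: (rmorph_pchar (@polyC k) hk). Qed.

Let aC x y : a x y = a y x.
Proof. by rewrite /a /pencil -{1}AC0 -{1}AC1 !mxE. Qed.

Let axx x : a x x = 0.
Proof. by rewrite /a /pencil Axx0 Axx1 mul0r addr0. Qed.

Lemma size_kernel_poly j : (size (kernel_poly j) <= m.+1)%N.
Proof. exact: size_pfaffian_pencil. Qed.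

Lemma kernel_coef_gt i : (m < i)%N -> kernel_coef i = 0.
Proof.
move=> mi; apply/rowP => j; rewrite !mxE nth_default //.
exact: leq_trans (size_kernel_poly j) mi.
Qed.

Lemma kernel_coef0 : kernel_coef 0 *m A0 = 0.
Proof.
apply/rowP => l.
have /(congr1 (fun p : {poly k} => p`_0)) := pfaffian_vector_kernel hP aC axx l.
rewrite coef_sum coef0 mxE => E; rewrite [RHS]mxE -[RHS]E; apply: eq_bigr => j _.
rewrite /a /pencil mulrDl coefD coefCM -mulrA coefCM coefXM /= mulr0 addr0.
by rewrite mxE mulrC -{1}AC0 mxE.
Qed.

Lemma kernel_coefS i : kernel_coef i.+1 *m A0 = kernel_coef i *m A1.
Proof.
apply/rowP => l.
have /(congr1 (fun p : {poly k} => p`_i.+1)) := pfaffian_vector_kernel hP aC axx l.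
rewrite coef_sum coef0 !mxE => E; apply/eqP; rewrite -subr_eq0 (oppr_pchar2 hk).
rewrite -big_split -[X in _ == X]E; apply/eqP/eq_bigr => j _ /=.
rewrite /a /pencil mulrDl coefD coefCM -mulrA coefCM coefXM /=.
by rewrite ![kernel_coef _ _ _]mxE -{1}AC0 -{1}AC1 !mxE; ring.
Qed.

(** By symmetry b_1 (w_i, w_j) = b_0 (w_(i+1), w_j) = b_0 (w_j, w_(i+1)), which is
    b_1 (w_(j-1), w_(i+1)) if j > 0 and 0 if j = 0: the value depends on i + j
    only, and the case j = 0 shows that it is zero. *)
Lemma kernel_coef_iso1 i j : kernel_coef i *m A1 *m (kernel_coef j)^T = 0.
Proof.
have C (B : 'M[k]_n) x y : B^T = B ->
    kernel_coef x *m B *m (kernel_coef y)^T = kernel_coef y *m B *m (kernel_coef x)^T.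
  move=> BC; have E (M : 'M[k]_1) : M^T = M by apply/matrixP => p q; rewrite mxE !ord1.
  by rewrite -[RHS]E !trmx_mul trmxK BC mulmxA.
elim: j i => [|j IHj] i; last first.
  by rewrite -kernel_coefS C // kernel_coefS C // -kernel_coefS C // kernel_coefS IHj.
by rewrite -kernel_coefS C // kernel_coef0 mul0mx.
Qed.

Lemma kernel_coef_iso0 i j : kernel_coef i *m A0 *m (kernel_coef j)^T = 0.
Proof. by case: i => [|i]; rewrite ?kernel_coefS ?kernel_coef_iso1 // kernel_coef0 mul0mx. Qed.

(** The finite values of the parameter: (t_0, t_1) = (1, x). *)
Lemma kernel_poly_noroot (K : fieldType) (f : {rmorphism k -> K}) x :
  exists j, (map_poly f (kernel_poly j)).[x] != 0.
Proof.
have [|j jN] := @regular_pfaffian_vector k hk m d0 d1 A0 A1 AC0 Axx0 AC1 Axx1 reg K f 1 x.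
  by rewrite oner_eq0.
exists j; move: jN; rewrite /pfaffian_vector pfaffian_seq_pencil /homogenize.
rewrite (horner_coef_wide x (n := m.+1)); last first.
  by rewrite size_map_poly size_kernel_poly.
apply: contraNneq => E; rewrite -[X in _ == X]E; apply/eqP/eq_bigr => i _.
by rewrite coef_map expr1n mul1r.
Qed.

(** The point (0, 1) at infinity of the parameter line. *)
Lemma kernel_coef_top : kernel_coef m != 0.
Proof.
have [|j jN] := @regular_pfaffian_vector k hk m d0 d1 A0 A1 AC0 Axx0 AC1 Axx1 reg k idfun 0 1.
  by rewrite oner_eq0 orbT.
apply: contraNneq jN => /rowP/(_ j); rewrite !mxE => E.
rewrite /pfaffian_vector pfaffian_seq_pencil /homogenize big_ord_recr /=.
rewrite -/(pfaffian_vector a j) -/(kernel_poly j) E mul0r addr0.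
rewrite big1 // => i _; rewrite expr0n subn_eq0.
by rewrite leqNgt ltn_ord mul0r mulr0.
Qed.

(** A nonconstant common divisor of the entries would have a root in an
    extension, a zero of w. *)
Lemma kernel_poly_bezout : exists u, \sum_j u j * kernel_poly j = 1.
Proof.
have [u Hu] := common_divisor kernel_poly; set g := \sum_j _ in Hu.
suff /size_poly1P[c c0 gc] : size g == 1%N.
  exists (fun j => c^-1%:P * u j).
  under eq_bigr do rewrite -mulrA; rewrite -big_distrr /= -/g gc -polyCM mulVf //.
apply/negPn/negP => g1.
have g0 : g != 0.
  apply: contraNneq kernel_coef_top => g0; apply/eqP/rowP => j; have := Hu j.
  by rewrite g0 dvd0p !mxE => /eqP->; rewrite coef0.
apply: (@root_extension k g) => [|K f x rx].
  by rewrite ltn_neqAle eq_sym g1 size_poly_gt0.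
have [j] := kernel_poly_noroot f x; case/negP; have /dvdpP[c ->] := Hu j.
by rewrite -/(root _ _) rmorphM rootM rx orbT.
Qed.

(** The kernel has rank one by [pfaffian_vector_unique]; with \sum_i u_i w_i = 1
    the factor is h = \sum_i u_i xi_i. *)
Lemma kernel_multiple (xi : 'I_n -> {poly k}) : (forall l, \sum_j xi j * a j l = 0) ->
  exists h, forall j, xi j = h * kernel_poly j.
Proof.
move=> axi; have [u u1] := kernel_poly_bezout; exists (\sum_i u i * xi i) => j.
rewrite big_distrl /= -[LHS]mul1r -u1 big_distrl /=; apply: eq_bigr => i _.
by rewrite -!mulrA; congr (_ * _); rewrite mulrC; apply: (pfaffian_vector_unique hP aC axx axi).
Qed.

(** The entries of w have no common factor and one of them has degree m, so a
    nonzero multiple of w has degree at least m. *)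
Lemma kernel_degree (xi : 'I_n -> {poly k}) : (forall l, \sum_j xi j * a j l = 0) ->
  (forall j, (size (xi j) <= m)%N) -> forall j, xi j = 0.
Proof.
move=> axi sxi; have [h xiE] := kernel_multiple axi.
suff h0 : h = 0 by move=> j; rewrite xiE h0 mul0r.
have /rV0Pn[j] := kernel_coef_top; rewrite !mxE => jm.
have sj : size (kernel_poly j) = m.+1.
  by apply/eqP; rewrite eqn_leq size_kernel_poly ltnNge; apply: contra jm => /leq_sizeP->.
apply: contraTeq (sxi j) => h0; rewrite -ltnNge xiE size_mul //; last first.
  by rewrite -size_poly_gt0 sj.
by rewrite sj addnS -[X in (X < _)%N]add0n ltn_add2r size_poly_gt0.
Qed.

(** Split the kernel vector C w as P + t^m Q with P of degree less than m.  Then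
    (A_0 + t A_1) P = t^m (A_0 + t A_1) Q has degree at most m and is divisible by
    t^m, so it is t^m times the coefficient of degree m, which is the relation in
    the hypothesis.  Hence Q is in the kernel; its degree is less than m, so
    Q = 0, and then C w has degree less than m, which forces C = 0. *)
Lemma kernel_coef_relation (C : {poly k}) : (size C <= m)%N ->
  \sum_(i < m) C`_(m.-1 - i) *: (kernel_coef i *m A1) = 0 -> C = 0.
Proof.
move=> sC CA.
pose P j := take_poly m (C * kernel_poly j); pose Q j := drop_poly m (C * kernel_poly j).
have CE j : C * kernel_poly j = P j + Q j * 'X^m by rewrite poly_take_drop.
have sCk j : (size (C * kernel_poly j)%R <= m + m)%N.
  apply: (leq_trans (size_polyMleq _ _)); have := size_kernel_poly j; lia.
have Q0 : forall j, Q j = 0.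
  apply: kernel_degree => [l|j]; last by rewrite size_drop_poly leq_subLR.
  set D := \sum_j _.
  have E : D * 'X^m = \sum_j P j * a j l.
    have : \sum_j C * kernel_poly j * a j l = 0.
      under eq_bigr do rewrite -mulrA; rewrite -big_distrr /=.
      under eq_bigr => j _ do rewrite aC mulrC.
      by rewrite [X in _ * X](pfaffian_vector_kernel hP aC axx) mulr0.
    under eq_bigr => j _ do rewrite CE mulrDl mulrAC.
    rewrite big_split -big_distrl /= -/D => /eqP.
    by rewrite addr_eq0 (oppr_pchar2 hP) => /eqP.
  apply/polyP => i; rewrite coef0.
  have -> : D`_i = (D * 'X^m)`_(i + m) by rewrite coefMXn ltnNge leq_addl addnK.
  rewrite E coef_sum.
  have PE j : (P j * a j l)`_(i + m) = if i is 0 then (P j)`_m.-1 * A1 j l else 0.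
    have sP x : (m <= x)%N -> (P j)`_x = 0 by rewrite coef_take_poly ltnNge => ->.
    rewrite mulrC /a /pencil mulrDl coefD coefCM -mulrA coefCM coefXM.
    rewrite addn_eq0 andbC -[m == _]negbK -lt0n m0 /= sP ?leq_addl // mulr0 add0r.
    case: i => [|i]; first by rewrite mulrC.
    by rewrite addSn sP ?mulr0 ?leq_addl.
  under eq_bigr => j _ do rewrite PE.
  case: i {PE} => [|i]; last by rewrite big1.
  move/rowP/(_ l): CA; rewrite mxE summxE => CAl; rewrite -[RHS]CAl.
  under [RHS]eq_bigr => i _ do rewrite mxE mxE big_distrr /=.
  rewrite [RHS]exchange_big; apply: eq_bigr => j _ /=.
  rewrite coef_take_poly prednK // leqnn coefMr prednK // big_distrl /=.
  by apply: eq_bigr => i _; rewrite mxE mulrA.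
have sCm j : (size (C * kernel_poly j)%R <= m)%N by rewrite CE Q0 mul0r addr0 size_take_poly.
have /rV0Pn[j] := kernel_coef_top; rewrite !mxE => jm.
apply: contraTeq (sCm j) => C0; have sj : size (kernel_poly j) = m.+1.
  by apply/eqP; rewrite eqn_leq size_kernel_poly ltnNge; apply: contra jm => /leq_sizeP->.
rewrite -ltnNge size_mul ?sj ?addnS //.
  by rewrite -[X in (X < _)%N]add0n ltn_add2r size_poly_gt0.
by rewrite -size_poly_gt0 sj.
Qed.

(** The rows of the first matrix are the functionals y_i of the normal form; those
    of the second are the vectors dual to the x_i. *)
Definition pairing_mx := \matrix_(i < m) (kernel_coef i *m A1).
Definition kernel_mx := \matrix_(i < m.+1) kernel_coef i.

(** A relation with coefficients z is a polynomial C as in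
    [kernel_coef_relation], with the coefficients in reverse order. *)
Lemma pairing_mx_free : row_free pairing_mx.
Proof.
apply: row_free_injP => z zY.
have C0 : \poly_(i < m) z 0 (rev_ord (insubd (Ordinal m0) i)) = 0.
  apply: kernel_coef_relation; first exact: size_poly.
  rewrite -[RHS]zY mulmx_sum_row; apply: eq_bigr => i _; rewrite rowK coef_poly.
  have im : (m.-1 - i < m)%N by have := ltn_ord i; lia.
  rewrite im; congr (z 0 _ *: _); apply/val_inj => /=; rewrite insubdK // /=.
  by have := ltn_ord i; lia.
apply/rowP => i; move/(congr1 (fun p : {poly k} => p`_(rev_ord i))): C0.
rewrite coef0 coef_poly ltn_ord mxE => <-; congr (z 0 _).
by rewrite valKd rev_ordK.
Qed.

Lemma kernel_mx_A0 (z : 'rV_m.+1) :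
  z *m kernel_mx *m A0 = (\row_(i < m) z 0 (lift ord0 i)) *m pairing_mx.
Proof.
rewrite [z *m kernel_mx]mulmx_sum_row mulmx_suml big_ord_recl.
rewrite [X in X + _](_ : _ = 0) ?add0r; last first.
  by rewrite rowK -scalemxAl kernel_coef0 scaler0.
rewrite mulmx_sum_row; apply: eq_bigr => i _.
by rewrite !rowK mxE -scalemxAl kernel_coefS.
Qed.

Lemma kernel_mx_A1 (z : 'rV_m.+1) :
  z *m kernel_mx *m A1 = (\row_(i < m) z 0 (widen_ord (leqnSn m) i)) *m pairing_mx.
Proof.
rewrite [z *m kernel_mx]mulmx_sum_row mulmx_suml big_ord_recr /=.
rewrite [X in _ + X](_ : _ = 0) ?addr0; last first.
  by rewrite rowK -scalemxAl -kernel_coefS kernel_coef_gt // mul0mx scaler0.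
rewrite mulmx_sum_row; apply: eq_bigr => i _.
by rewrite !rowK mxE -scalemxAl.
Qed.

(** Applying A_0 and A_1 to a relation among the w_i gives relations among the
    y_i, which kill all the coefficients but the first, respectively all but the
    last. *)
Lemma kernel_mx_free : row_free kernel_mx.
Proof.
apply: row_free_injP => z zW.
have zl i : z 0 (lift ord0 i) = 0.
  move/(congr1 (mulmx^~ A0)): zW; rewrite kernel_mx_A0 mul0mx => /eqP.
  by rewrite mulmx_free_eq0 ?pairing_mx_free // => /eqP/rowP/(_ i); rewrite !mxE.
have zw i : z 0 (widen_ord (leqnSn m) i) = 0.
  move/(congr1 (mulmx^~ A1)): zW; rewrite kernel_mx_A1 mul0mx => /eqP.
  by rewrite mulmx_free_eq0 ?pairing_mx_free // => /eqP/rowP/(_ i); rewrite !mxE.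
apply/rowP => i; rewrite mxE; case: (unliftP ord0 i) => [j ->|->]; first exact: zl.
by rewrite -[RHS](zw (Ordinal m0)); congr (z 0 _); apply/val_inj.
Qed.

Lemma pairing_kernel_mx : pairing_mx *m kernel_mx^T = 0.
Proof.
apply/matrixP => i j; rewrite [RHS]mxE.
have /matrixP/(_ 0 0) := kernel_coef_iso1 i j; rewrite [RHS]mxE => E; rewrite -[RHS]E.
by rewrite !mxE; apply: eq_bigr => l _; rewrite !mxE.
Qed.

Lemma kernel_mx_iso : kernel_mx *m A0 *m kernel_mx^T = 0 /\ kernel_mx *m A1 *m kernel_mx^T = 0.
Proof.
have E (B : 'M[k]_n) (i j : 'I_m.+1) :
    (kernel_mx *m B *m kernel_mx^T) i j = (kernel_coef i *m B *m (kernel_coef j)^T) 0 0.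
  have wE (l : 'I_m.+1) : kernel_coef l = row l kernel_mx by rewrite rowK.
  by rewrite !wE -row_mul !mxE; apply: eq_bigr => l _; rewrite !mxE.
by split; apply/matrixP => i j; rewrite E (kernel_coef_iso0, kernel_coef_iso1) !mxE.
Qed.
End Kronecker.

(** * Coordinates adapted to a generator *)

(** If P_1 is singular, (t_0, t_1) = (0, 1) works; otherwise take an eigenvector
    of P_0 P_1^-1 over an extension. *)
Lemma pencil_has_eigenvector (F : fieldType) d (P0 P1 : 'M[F]_d) : (0 < d)%N ->
  (forall (K : fieldType) (f : {rmorphism F -> K}) (v : 'rV[K]_d) t0 t1, v != 0 ->
     (t0 != 0) || (t1 != 0) ->
     t0 *: (v *m map_mx f P0) + t1 *: (v *m map_mx f P1) = 0 -> False) -> False.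
Proof.
move=> d0 nosing; have [/eqP/det0P[v v0 vP]|nz] := eqVneq (\det P1) 0.
  apply: (nosing F idfun v 0 1) => //; first by rewrite oner_eq0 orbT.
  have -> : map_mx idfun P1 = P1 by apply/matrixP => i j; rewrite mxE.
  by rewrite vP scale0r scaler0 addr0.
have P1u : P1 \in unitmx by rewrite unitmxE unitfE.
apply: (@root_extension F (char_poly (P0 *m invmx P1))) => [|K f x].
  by rewrite size_char_poly ltnS.
rewrite map_char_poly -eigenvalue_root_char => /eigenvalueP[v vE v0].
apply: (nosing K f v 1 (- x)) => //; first by rewrite oner_eq0.
rewrite scale1r scaleNr scalemxAl -vE -mulmxA -map_mxM -mulmxA mulVmx //.
by rewrite mulmx1 subrr.
Qed.

Definition totally_singular (R : comNzRingType) n p (d : 'rV[R]_n) A (L : 'M[R]_(p, n)) :=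
  L *m A *m L^T = 0 /\ forall i, qf d A (row i L) = 0.

Lemma totally_singular_qf (R : comNzRingType) (hR : 2%N \in [pchar R]) n p
    (d : 'rV[R]_n) A (L : 'M[R]_(p, n)) : A^T = A -> (forall i, A i i = 0) ->
  totally_singular d A L -> forall z, qf d A (z *m L) = 0.
Proof.
move=> AC Axx [LA Lq] z; rewrite qf_mul // big1 // => i _; by rewrite Lq mulr0.
Qed.

Lemma totally_singular_map (R S : comNzRingType) (f : {rmorphism R -> S}) n p
    (d : 'rV[R]_n) A (L : 'M[R]_(p, n)) :
  totally_singular d A L -> totally_singular (map_mx f d) (map_mx f A) (map_mx f L).
Proof.
move=> [LA Lq]; split=> [|i]; first by rewrite map_trmx -!map_mxM LA map_mx0.
by rewrite -map_row qf_map Lq rmorph0.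
Qed.

Section Splitting.
Variables (k : fieldType) (hk : 2%N \in [pchar k]) (m : nat).
Notation n := (m.*2.+1).
Variables (d0 d1 : 'rV[k]_n) (A0 A1 : 'M[k]_n).
Hypotheses (AC0 : A0^T = A0) (Axx0 : forall i, A0 i i = 0).
Hypotheses (AC1 : A1^T = A1) (Axx1 : forall i, A1 i i = 0).
Hypothesis reg : regular_forms d0 d1 A0 A1.
Hypothesis m0 : (0 < m)%N.

Notation kv := (kernel_coef A0 A1).
Notation W := (kernel_mx A0 A1).
Notation Y := (pairing_mx A0 A1).

Let WA := kernel_mx_iso hk AC0 Axx0 AC1 Axx1.

Section Generator.
Variable L : 'M[k]_(m, n).
Hypothesis Lfree : row_free L.
Hypotheses (L0 : totally_singular d0 A0 L) (L1 : totally_singular d1 A1 L).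

(** Let D be a basis of the intersection and B one of the functionals vanishing on
    L + W.  The two have the same number of elements, and D A_0 and D A_1 are
    combinations of B because L and W are isotropic.  An eigenvector of this square pencil contradicts
    regularity, since q_0 and q_1 vanish on L. *)
Lemma generator_transversal : (W :&: L)%MS = 0.
Proof.
apply/eqP; rewrite -mxrank_eq0 -leqn0 leqNgt; apply/negP => dpos.
pose D := row_base (W :&: L)%MS; pose Z := col_mx W L.
have [DW DL] : (D <= W)%MS /\ (D <= L)%MS.
  by split; rewrite eq_row_base ?capmxSl ?capmxSr.
have Wfree := kernel_mx_free hk AC0 Axx0 AC1 Axx1 reg m0.
have [|B ZB] := @supmx_of_rank k _ _ (\rank (W :&: L)%MS) (kermx Z^T).
  rewrite mxrank_ker mxrank_tr -addsmxE.
  have := mxrank_sum_cap W L; rewrite (eqP Wfree) (eqP Lfree); lia.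
have DB A : W *m A *m W^T = 0 -> L *m A *m L^T = 0 -> exists P, D *m A = P *m B.
  move=> WA0 LA0; apply/submxP; apply: submx_trans ZB; apply/sub_kermxP.
  have [X1 DX1] := submxP DW; have [X2 DX2] := submxP DL.
  rewrite tr_col_mx mul_mx_row {1}DX1 DX2 -!mulmxA !(mulmxA _ A) WA0 LA0.
  by rewrite !mulmx0 row_mx0.
have [P0 DP0] := DB _ WA.1 L0.1; have [P1 DP1] := DB _ WA.2 L1.1.
apply: (@pencil_has_eigenvector k _ P0 P1 dpos) => K f v t0 t1 v0 t01 vP.
have hK : 2%N \in [pchar K] by exact: (rmorph_pchar f hk).
have [X DX] := submxP DL.
have vq d A : A^T = A -> (forall i, A i i = 0) -> totally_singular d A L ->
    qf (map_mx f d) (map_mx f A) (v *m map_mx f D) = 0.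
  move=> AC Axx tsL; rewrite DX map_mxM mulmxA; apply: totally_singular_qf => //.
  - by rewrite map_trmx AC.
  - by move=> i; rewrite mxE Axx rmorph0.
  - exact: totally_singular_map.
have [||||/eqP + /eqP] := @reg K f (v *m map_mx f D) _ _ _ t0 t1.
- by rewrite mulmx_free_eq0 // row_free_map row_base_free.
- exact: vq.
- exact: vq.
- rewrite -!mulmxA -!map_mxM DP0 DP1 !map_mxM !mulmxA (scalemxAl t0) (scalemxAl t1) -mulmxDl.
  by rewrite vP mul0mx.
by case/orP: t01 => /negPf->.
Qed.

(** X computes the coordinates along W with respect to the decomposition of the
    space as W + L, and [kernel_mx_A0], [kernel_mx_A1] compute the pairing of W
    with L. *)
Lemma generator_coords : exists X : 'M[k]_(n, m.+1),
  [/\ W *m X = 1%:M,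
      forall v, qf d0 A0 v = \sum_(i < m.+1) qf d0 A0 (kv i) * (v *m X) 0 i ^+ 2 +
          \sum_(i < m) (v *m X) 0 (lift ord0 i) * (v *m Y^T) 0 i
    & forall v, qf d1 A1 v = \sum_(i < m.+1) qf d1 A1 (kv i) * (v *m X) 0 i ^+ 2 +
          \sum_(i < m) (v *m X) 0 (widen_ord (leqnSn m) i) * (v *m Y^T) 0 i].
Proof.
have Wfree := kernel_mx_free hk AC0 Axx0 AC1 Axx1 reg m0.
pose Z := col_mx W L; have Zr : \rank Z = n.
  rewrite -addsmxE; have := mxrank_sum_cap W L.
  rewrite generator_transversal mxrank0 (eqP Wfree) (eqP Lfree); lia.
have Zfull : row_full Z by rewrite /row_full Zr.
have Zfree : row_free Z by rewrite /row_free Zr; apply/eqP; lia.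
pose X := pinvmx Z *m col_mx 1%:M 0; pose X' := pinvmx Z *m col_mx 0 1%:M.
have vE v : v = v *m X *m W + v *m X' *m L.
  have vZ : (v <= Z)%MS by exact: submx_full.
  rewrite -[LHS](mulmxKpV vZ) -{2}[Z]mul1mx.
  rewrite -[1%:M](_ : row_mx (col_mx 1%:M 0) (col_mx 0 1%:M) = _); last first.
    by rewrite -block_mxEh -scalar_mx_block.
  by rewrite mul_row_col mulmxDr !mulmxA.
have WX : W *m X = 1%:M.
  have WZ : W = row_mx 1%:M 0 *m Z by rewrite mul_row_col mul1mx mul0mx addr0.
  have ZX : Z *m X = col_mx 1%:M 0 by rewrite /X mulmxA mulmxVp // mul1mx.
  by rewrite [W in LHS]WZ -mulmxA ZX mul_row_col mulmx1 mulmx0 addr0.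
(* Keeps associativity of the product from being applied inside X and X'. *)
clearbody X X'.
have YW := pairing_kernel_mx hk AC0 Axx0 AC1 Axx1.
have pairing v x' : x' *m Y *m (v *m X' *m L)^T = x' *m (v *m Y^T)^T.
  rewrite [(v *m Y^T)^T]trmx_mul trmxK mulmxA [in RHS](vE _ v) linearD /= mulmxDr.
  by rewrite [(_ *m W)^T]trmx_mul (mulmxA _ W^T) -(mulmxA x' Y W^T) YW mulmx0 mul0mx add0r.
exists X; split.
- by [].
- move=> v; rewrite {1}(vE _ v) qfD // (totally_singular_qf hk AC0 Axx0 L0) addr0.
  rewrite /bil kernel_mx_A0 // pairing qf_mul ?WA.1 //; congr (_ + _).
    by apply: eq_bigr => i _; rewrite rowK mulrC.
  by rewrite mxE; apply: eq_bigr => i _; rewrite !mxE.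
- move=> v; rewrite {1}(vE _ v) qfD // (totally_singular_qf hk AC1 Axx1 L1) addr0.
  rewrite /bil kernel_mx_A1 // pairing qf_mul ?WA.2 //; congr (_ + _).
    by apply: eq_bigr => i _; rewrite rowK mulrC.
  by rewrite mxE; apply: eq_bigr => i _; rewrite !mxE.
Qed.
End Generator.
End Splitting.

(** * Semilinear equations over an algebraically closed field *)
Lemma closed_root (k : fieldType) (p : {poly k}) :
  GRing.closed_field_axiom k -> (1 < size p)%N -> exists x, root p x.
Proof.
move=> closedk p1; have l0 : lead_coef p != 0.
  by rewrite lead_coef_eq0 -size_poly_gt0 ltnW.
have [|x xE] := closedk (size p).-1 (fun i => - (p`_i / lead_coef p)).
  by rewrite -subn1 subn_gt0.
exists x; rewrite /root horner_coef -(ltn_predK p1) big_ord_recr /= xE.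
rewrite -/(lead_coef p) mulr_sumr -big_split /= big1 // => i _.
by rewrite mulNr mulrN mulrA mulrCA divff // mulr1 subrr.
Qed.

Section Semilinear.
Variables (k : fieldType) (hk : 2%N \in [pchar k]).
Hypothesis closedk : GRing.closed_field_axiom k.
Variables (N : nat) (T : 'rV[k]_N -> 'rV[k]_N).
Hypotheses (TD : forall u v, T (u + v) = T u + T v)
  (TZ : forall c v, T (c *: v) = c ^+ 2 *: T v).

Let T0 : T 0 = 0. Proof. by have := TZ 0 0; rewrite scale0r expr0n scale0r. Qed.

Let T_sum n (u : 'I_n -> 'rV[k]_N) : T (\sum_i u i) = \sum_i T (u i).
Proof. exact: (big_morph T TD T0). Qed.

(** The N + 1 vectors r, T r, ..., T^N r are dependent; solve a relation for its
    highest term. *)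
Lemma iter_relation r : exists d (c : nat -> k),
  iter d T r = \sum_(i < d) c i *: iter i T r.
Proof.
pose M := \matrix_(i < N.+1) iter i T r.
have : kermx M != 0.
  by rewrite kermx_eq0 /row_free ltn_eqF // ltnS rank_leq_col.
case/rowV0Pn=> c /sub_kermxP cM /rV0Pn[i0 ci0].
have [d cd dmax] := @arg_maxnP _ i0 (fun i => c 0 i != 0) val ci0.
exists d, (fun i => - (c 0 (inord i) / c 0 d)).
apply: (scalerI cd); rewrite scaler_sumr.
under eq_bigr => i _ do rewrite scalerA mulrN mulrCA divff // mulr1 scaleNr.
apply/eqP; rewrite sumrN -addr_eq0 addrC; apply/eqP.
pose F i := c 0 (inord i) *: iter i T r.
have -> : c 0 d *: iter d T r = F d by rewrite /F inord_val.
transitivity (\sum_(i < d.+1) F i); first by rewrite big_ord_recr.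
rewrite -[RHS]cM mulmx_sum_row.
rewrite (big_ord_widen N.+1 F) // big_mkcond; apply: eq_bigr => i _.
rewrite rowK /F inord_val; case: ifPn => // di.
have [->|ci] := eqVneq (c 0 i) 0; first by rewrite scale0r.
by case/negP: di; exact: dmax i ci.
Qed.

(** With T^(d+1) r = \sum_i c_i T^i r, the vector s = \sum_(i <= d) z_i T^i r solves
    s + T s = r if z_0 = 1 + c_0 z_d^2 and z_i = z_(i-1)^2 + c_i z_d^2.  The
    polynomial [iterpol c i] is z_i as a function of z_d. *)
Fixpoint iterpol (c : nat -> k) i : {poly k} :=
  (if i is j.+1 then iterpol c j ^+ 2 else 1) + (c i)%:P * 'X^2.

(** It remains to find z with z = P_d (z), where P_d is [iterpol c d].  As P_d is a
    polynomial in X^2, the derivative of X + P_d is 1, so X + P_d is not constant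
    and has a root. *)
Lemma semilinear_onto r : exists s, s + T s = r.
Proof.
have [[|d] [c Tr]] := iter_relation r.
  by exists 0; rewrite T0 addr0 -[r]/(iter 0 T r) Tr big_ord0.
pose p := 'X + iterpol c d.
have D0 i : (iterpol c i)^`() = 0.
  have e2 (q : {poly k}) : (q ^+ 2)^`() = 0.
    by rewrite deriv_exp -mulr_natr -polyC_natr (pcharf0 hk) mulr0.
  case: i => [|i] /=; rewrite derivD derivM derivC mul0r add0r (e2 'X) mulr0 addr0.
    by rewrite -[1]/(1%:P) derivC.
  exact: e2.
have [z] : exists z, root p z.
  apply: closed_root => //; rewrite ltnNge; apply/negP => /size1_polyC pC.
  have /eqP := congr1 (@deriv k) pC; rewrite derivC derivD derivX D0 addr0.
  by rewrite oner_eq0.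
rewrite /root hornerD hornerX addr_eq0 (oppr_pchar2 hk) => /eqP zE.
exists (\sum_(i < d.+1) (iterpol c i).[z] *: iter i T r).
pose S := \sum_(i < d) (iterpol c i).[z] ^+ 2 *: iter i.+1 T r.
pose S' := z ^+ 2 *: iter d.+1 T r.
have -> : T (\sum_(i < d.+1) (iterpol c i).[z] *: iter i T r) = S + S'.
  rewrite T_sum big_ord_recr /= TZ -zE; congr (_ + _).
  by apply: eq_bigr => i _; rewrite TZ.
have -> : \sum_(i < d.+1) (iterpol c i).[z] *: iter i T r = r + S + S'.
  have E i : (iterpol c i).[z] =
      (if i is j.+1 then (iterpol c j).[z] ^+ 2 else 1) + z ^+ 2 * c i.
    by case: i => [|i]; rewrite /= hornerD hornerCM hornerXn ?horner_exp ?hornerC; ring.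
  under eq_bigr => i _ do rewrite E scalerDl -scalerA.
  rewrite big_split -scaler_sumr -Tr; congr (_ + _).
  by rewrite big_ord_recl scale1r.
have x2 (v : 'rV[k]_N) : v + v = 0 by rewrite -mulr2n -scaler_nat (pcharf0 hk) scale0r.
by rewrite -!addrA [S' + _]addrCA x2 addr0 x2 addr0.
Qed.
End Semilinear.

(** * Generators over an algebraically closed field *)
Section LinearPart.
Variables (k : fieldType) (hk : 2%N \in [pchar k]) (b0 b1 : nat -> nat -> k).
Hypotheses (b0C : forall i j, b0 i j = b0 j i) (b0xx : forall i, b0 i i = 0).
Hypotheses (b1C : forall i j, b1 i j = b1 j i) (b1xx : forall i, b1 i i = 0).

(** The value of phi at (i, i + d).  The two families of equations of
    [zigzag_solution] link (i, j) to (j, i), and (i, j) to (j + 1, i - 1), so each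
    antidiagonal is a path.  Two steps of it lead from (i, i + d) to
    (i + 1, i + d - 1), and the recursion starts from 0 at the middle. *)
Fixpoint zigzag (d i : nat) : k :=
  if d is d'.+1 then
    b1 i (i + d'.+1)%N + b0 i (i + d')%N + (if d' is d''.+1 then zigzag d'' i.+1 else 0)
  else 0.

(** This is the isotropy of the vectors u_p + \sum_j phi_(j,p) w_j, where b0 and b1
    are the values of the two polar forms on the u_p. *)
Lemma zigzag_solution : exists phi : nat -> nat -> k, forall p q,
  phi q.+1 p + phi p.+1 q = b0 p q /\ phi q p + phi p q = b1 p q.
Proof.
pose phi i j := if (i <= j)%N then zigzag (j - i) i
                else zigzag (i - j.+2) j.+1 + b0 i.-1 j.
have phile i d : phi i (i + d)%N = zigzag d i by rewrite /phi leq_addr addKn.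
have phigt j d : phi (j + d.+1)%N j = zigzag d.-1 j.+1 + b0 (j + d)%N j.
  rewrite /phi leqNgt addnS ltnS leq_addr /=.
  by have -> : ((j + d).+1 - j.+2 = d.-1)%N by lia.
have x2 (x : k) : x + x = 0 by exact: addrr_pchar2 hk x.
have E1 p d : phi (p + d)%N p + phi p (p + d)%N = b1 p (p + d)%N.
  case: d => [|d]; first by rewrite addn0 x2 b1xx.
  rewrite phigt phile /= [b0 (p + d)%N p]b0C.
  have K (x y w : k) : x + y + (w + y + x) = w.
    have -> : x + y + (w + y + x) = w + (x + x) + (y + y) by ring.
    by rewrite !x2 !addr0.
  by case: d => [|d]; exact: K.
have E0 p d : phi (p + d).+1 p + phi p.+1 (p + d)%N = b0 p (p + d)%N.
  rewrite -addnS phigt; case: d => [|d].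
    by rewrite addn0 -{2}addn1 phigt addn0 x2 b0xx.
  by rewrite addnS -addSn phile addSn -addnS addrAC x2 add0r b0C.
exists phi => p q; case: (leqP p q) => [pq|/ltnW qp].
  by rewrite -(subnKC pq) E0 E1.
by rewrite -(subnKC qp) [X in X = _ /\ _]addrC [X in _ /\ X = _]addrC E0 E1 b0C b1C.
Qed.
End LinearPart.


Section ClosedGenerator.
Variables (k : fieldType) (hk : 2%N \in [pchar k]) (m : nat).
Hypothesis closedk : GRing.closed_field_axiom k.
Notation n := (m.*2.+1).
Variables (d0 d1 : 'rV[k]_n) (A0 A1 : 'M[k]_n).
Hypotheses (AC0 : A0^T = A0) (Axx0 : forall i, A0 i i = 0).
Hypotheses (AC1 : A1^T = A1) (Axx1 : forall i, A1 i i = 0).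
Hypothesis reg : regular_forms d0 d1 A0 A1.
Hypothesis m0 : (0 < m)%N.

Notation kv := (kernel_coef A0 A1).
Notation Y := (pairing_mx A0 A1).

Lemma dual_vectors : exists u : nat -> 'rV[k]_n,
  forall i j, (i < m)%N -> (j < m)%N -> bil A1 (kv i) (u j) = (i == j)%:R.
Proof.
have /row_freeP[B YB] := pairing_mx_free hk AC0 Axx0 AC1 Axx1 reg m0.
exists (fun j => \row_l B l (insubd (Ordinal m0) j)) => i j im jm.
have := congr1 (fun M : 'M_m => M (Ordinal im) (Ordinal jm)) YB; rewrite !mxE => E.
rewrite -[RHS]/((Ordinal im == Ordinal jm)%:R) -[RHS]E /bil mxE.
apply: eq_bigr => l _; rewrite !mxE; congr (_ * B l _).
by apply/val_inj; rewrite /= insubdK.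
Qed.

(** In the unknowns s the conditions that q_0 and q_1 vanish at the p-th basis
    vector have linear terms s_(2p+1) and s_(2p), so the h-th condition is the one
    for p = h./2 and the form given by the parity of h, and the system has the
    shape s + T s = r. *)
Lemma closed_generator : exists L : 'M[k]_(m, n),
  [/\ row_free L, totally_singular d0 A0 L & totally_singular d1 A1 L].
Proof.
have [u ku1] := dual_vectors.
have ku0 i j : (i <= m)%N -> (j < m)%N -> bil A0 (kv i) (u j) = (i == j.+1)%:R.
  case: i => [|i] im jm; first by rewrite /bil kernel_coef0 // !mul0mx mxE.
  by rewrite /bil kernel_coefS // -/(bil A1 (kv i) (u j)) ku1.
have ku1' i j : (i <= m)%N -> (j < m)%N -> bil A1 (kv i) (u j) = (i == j)%:R.
  rewrite leq_eqVlt => /orP[/eqP->|im] jm; last exact: ku1.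
  by rewrite /bil -kernel_coefS // kernel_coef_gt // !mul0mx mxE gtn_eqF.
have [||||phi0 phi0E] := @zigzag_solution k hk (fun i j => bil A0 (u i) (u j))
    (fun i j => bil A1 (u i) (u j)).
- by move=> i j; rewrite bilC.
- by move=> i; rewrite (bilxx hk d0).
- by move=> i j; rewrite bilC.
- by move=> i; rewrite (bilxx hk d1).
(* Entries of s with a natural number as index, zero out of range. *)
pose se (s : 'rV[k]_(m.*2)) i := if insub i is Some i' then s 0 i' else 0.
have seD s t i : se (s + t) i = se s i + se t i.
  by rewrite /se; case: insub => [i'|]; rewrite ?mxE ?addr0.
have seZ c s i : se (c *: s) i = c * se s i.
  by rewrite /se; case: insub => [i'|]; rewrite ?mxE ?mulr0.
have sqD (x y : k) : (x + y) ^+ 2 = x ^+ 2 + y ^+ 2.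
  by rewrite sqrrD -mulr_natr (pcharf0 hk) mulr0 addr0.
pose Qk (b : bool) j := if b then qf d0 A0 (kv j) else qf d1 A1 (kv j).
pose T s := \row_(h < m.*2) \sum_(j < m.+1) se s (j + h./2)%N ^+ 2 * Qk (odd h) j.
have TD s t : T (s + t) = T s + T t.
  apply/rowP => h; rewrite !mxE -big_split; apply: eq_bigr => j _ /=.
  by rewrite seD sqD mulrDl.
have TZ c s : T (c *: s) = c ^+ 2 *: T s.
  apply/rowP => h; rewrite !mxE mulr_sumr; apply: eq_bigr => j _ /=.
  by rewrite seZ exprMn mulrA.
pose Qu (b : bool) p := if b then qf d0 A0 (u p) + phi0 p.+1 p else qf d1 A1 (u p) + phi0 p p.
have [s sE] := semilinear_onto hk closedk TD TZ (\row_(h < m.*2)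
   (Qu (odd h) h./2 + \sum_(j < m.+1) phi0 j h./2 ^+ 2 * Qk (odd h) j)).
have sEh (b : bool) p : (p < m)%N -> se s (b + p.*2)%N +
    \sum_(j < m.+1) se s (j + p)%N ^+ 2 * Qk b j =
    Qu b p + \sum_(j < m.+1) phi0 j p ^+ 2 * Qk b j.
  move=> pm; have hm : (b + p.*2 < m.*2)%N by case: b; lia.
  have /rowP/(_ (Ordinal hm)) := sE; rewrite !mxE /= oddD odd_double addbF oddb half_bit_double.
  by rewrite /se insubT.
(* Adding a Hankel matrix does not affect the isotropy. *)
pose phi j p := phi0 j p + se s (j + p)%N.
pose w p := \sum_(j < m.+1) phi j p *: kv j.
have pick (f : nat -> k) q : (q <= m)%N -> \sum_(j < m.+1) f j * (j == q :> nat)%:R = f q.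
  move=> qm; rewrite (bigD1 (Ordinal (qm : (q < m.+1)%N))) //= eqxx mulr1 big1 ?addr0 // => j jq.
  by rewrite (_ : (j == q :> nat) = false) ?mulr0 //; apply: negbTE.
have wu0 p q : (q < m)%N -> bil A0 (w p) (u q) = phi q.+1 p.
  move=> qm; rewrite bil_suml -(pick (phi^~ p)) //; apply: eq_bigr => j _.
  by rewrite ku0 // leq_ord.
have wu1 p q : (q < m)%N -> bil A1 (w p) (u q) = phi q p.
  move=> qm; rewrite bil_suml -(pick (phi^~ p)) 1?ltnW //; apply: eq_bigr => j _.
  by rewrite ku1' // leq_ord.
have kk0 i j : bil A0 (kv i) (kv j) = 0 by rewrite /bil kernel_coef_iso0 // mxE.
have kk1 i j : bil A1 (kv i) (kv j) = 0 by rewrite /bil kernel_coef_iso1 // mxE.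
have wk1 p j : bil A1 (w p) (kv j) = 0.
  by rewrite bil_suml big1 // => i _; rewrite kk1 mulr0.
have ww0 p q : bil A0 (w p) (w q) = 0.
  rewrite bil_suml big1 // => i _; rewrite bil_sumr // big1 ?mulr0 // => j _.
  by rewrite kk0 mulr0.
have ww1 p q : bil A1 (w p) (w q) = 0.
  by rewrite bil_sumr // big1 // => i _; rewrite wk1 mulr0.
have phiS p q : phi q.+1 p + phi p.+1 q = bil A0 (u p) (u q).
  rewrite /phi addrACA (phi0E p q).1 !addSn [(q + p)%N]addnC.
  by rewrite (addrr_pchar2 hk) addr0.
have phiC p q : phi q p + phi p q = bil A1 (u p) (u q).
  rewrite /phi addrACA (phi0E p q).2 [(q + p)%N]addnC.
  by rewrite (addrr_pchar2 hk) addr0.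
pose l p := u p + w p.
pose L := \matrix_(p < m) l p.
have LE A (p q : 'I_m) : (L *m A *m L^T) p q = bil A (l p) (l q).
  have lE (i : 'I_m) : l i = row i L by rewrite rowK.
  by rewrite /bil !lE -row_mul !mxE; apply: eq_bigr => i _; rewrite !mxE.
have qw0 p : qf d0 A0 (w p) = \sum_(j < m.+1) phi j p ^+ 2 * Qk true j.
  by apply: (qf_sum hk d0 AC0 Axx0); exact: kk0.
have qw1 p : qf d1 A1 (w p) = \sum_(j < m.+1) phi j p ^+ 2 * Qk false j.
  by apply: (qf_sum hk d1 AC1 Axx1); exact: kk1.
have phi2 b p : \sum_(j < m.+1) phi j p ^+ 2 * Qk b j =
    \sum_(j < m.+1) phi0 j p ^+ 2 * Qk b j + \sum_(j < m.+1) se s (j + p)%N ^+ 2 * Qk b j.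
  by rewrite -big_split; apply: eq_bigr => j _; rewrite sqD mulrDl.
have x2 (x : k) : x + x = 0 by exact: addrr_pchar2 hk x.
exists L; split.
- apply/row_freeP; exists Y^T; apply/matrixP => p i.
  have -> : (L *m Y^T) p i = bil A1 (l p) (kv i).
    rewrite bilC // /bil [LHS]mxE [RHS]mxE; apply: eq_bigr => x _.
    by rewrite mulrC [L _ _]mxE ![_^T _ _]mxE [Y _ _]mxE.
  by rewrite bilDl wk1 addr0 bilC // ku1 // mxE eq_sym.
- split.
    apply/matrixP => p q; rewrite LE [RHS]mxE -[RHS](x2 (bil A0 (u p) (u q))) -{2}phiS.
    rewrite bilDl !bilDr ww0 wu0 // [bil _ _ (w q)]bilC // wu0 //.
    by rewrite addr0 -addrA; congr (_ + _); exact: addrC.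
  move=> p; rewrite rowK qfD // bilC // wu0 // qw0 phi2 /phi.
  have := sEh true p (ltn_ord p); rewrite /Qu add1n -addnn -addSn => /eqP.
  rewrite -subr_eq0 (oppr_pchar2 hk) => /eqP E; rewrite -[RHS]E; ring.
- split.
    apply/matrixP => p q; rewrite LE [RHS]mxE -[RHS](x2 (bil A1 (u p) (u q))) -{2}phiC.
    rewrite bilDl !bilDr ww1 wu1 // [bil _ _ (w q)]bilC // wu1 //.
    by rewrite addr0 -addrA; congr (_ + _); exact: addrC.
  move=> p; rewrite rowK qfD // bilC // wu1 // qw1 phi2 /phi.
  have := sEh false p (ltn_ord p); rewrite /Qu add0n -addnn => /eqP.
  rewrite -subr_eq0 (oppr_pchar2 hk) => /eqP E; rewrite -[RHS]E; ring.
Qed.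
End ClosedGenerator.

(** * Coordinates of vectors and forms *)
Section Coordinates.
Variables (k : fieldType) (hk : 2%N \in [pchar k]) (E : vectType k) (n : nat).
Variables (e : n.-tuple E) (he : basis_of fullv e).

Definition coords (v : E) : 'rV[k]_n := \row_i coord e i v.
Definition vect (c : 'rV[k]_n) : E := \sum_i c 0 i *: tnth e i.
Definition diag_row (q : E -> k) : 'rV[k]_n := \row_i q (tnth e i).
Definition polar_form (q : E -> k) : 'M[k]_n :=
  \matrix_(i, j) polar q (tnth e i) (tnth e j).

Lemma coordsK : cancel coords vect.
Proof.
move=> v; rewrite /vect [RHS](coord_basis he (memvf v)).
by apply: eq_bigr => i _; rewrite mxE (tnth_nth 0).
Qed.

Lemma vectK : cancel vect coords.
Proof.
move=> c; apply/rowP => i; rewrite mxE /vect.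
under eq_bigr => j _ do rewrite (tnth_nth 0).
by rewrite coord_sum_free // (basis_free he).
Qed.

Lemma coordsD u v : coords (u + v) = coords u + coords v.
Proof. by apply/rowP => i; rewrite !mxE linearD. Qed.

Lemma coordsZ c v : coords (c *: v) = c *: coords v.
Proof. by apply/rowP => i; rewrite !mxE linearZ. Qed.

Section Form.
Variables (q : E -> k) (hq : quadratic_form q).

Lemma quadZ c v : q (c *: v) = c ^+ 2 * q v. Proof. exact: hq.1. Qed.

Lemma quad0 : q 0 = 0. Proof. by have := quadZ 0 0; rewrite scale0r expr0n mul0r. Qed.

Lemma polarC u v : polar q u v = polar q v u.
Proof. by rewrite /polar (addrC u) addrAC. Qed.

Lemma polarDr u v w : polar q u (v + w) = polar q u v + polar q u w.
Proof. by have := hq.2 u 1 v w; rewrite scale1r mul1r. Qed.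

Lemma polarZr c u v : polar q u (c *: v) = c * polar q u v.
Proof.
have p0 : polar q u 0 = 0 by rewrite /polar addr0 quad0 subrr subr0.
by have := hq.2 u c v 0; rewrite addr0 p0 addr0.
Qed.

Lemma polar_form_sym : (polar_form q)^T = polar_form q.
Proof. by apply/matrixP => i j; rewrite !mxE polarC. Qed.

Lemma polar_form_diag i : polar_form q i i = 0.
Proof.
have vv (v : E) : v + v = 0 by rewrite -mulr2n -scaler_nat (pcharf0 hk) scale0r.
by rewrite mxE /polar vv quad0 sub0r -opprD (addrr_pchar2 hk) oppr0.
Qed.

Lemma polar_coords u v : polar q u v = bil (polar_form q) (coords u) (coords v).
Proof.
have sumr x (c : 'rV_n) : polar q x (vect c) = \sum_i c 0 i * polar q x (tnth e i).
  under [RHS]eq_bigr => i _ do rewrite -polarZr.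
  apply: (big_morph (polar q x)) => [y z|]; first exact: polarDr.
  by have := polarZr 0 x 0; rewrite scale0r mul0r.
rewrite -{1}(coordsK u) -{1}(coordsK v) sumr /bil mxE; apply: eq_bigr => i _.
rewrite polarC sumr mulrC !mxE; congr (_ * _); apply: eq_bigr => j _.
by rewrite [polar_form _ _ _]mxE polarC.
Qed.

Lemma qf_delta (R : comNzRingType) (d : 'rV[R]_n) A i : qf d A (delta_mx 0 i) = d 0 i.
Proof.
rewrite /qf (bigD1 i) //= !mxE !eqxx expr1n mulr1 big1 ?addr0 => [|j ji]; last first.
  by rewrite mxE (negPf ji) andbF expr0n mulr0.
rewrite big1 ?addr0 // => a _; rewrite big1 // => b ab; rewrite !mxE eqxx /=.
by have [ai|] := eqVneq a i; have [bi|] := eqVneq b i; rewrite ?(mulr0, mul0r) //;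
  move: ab; rewrite ai bi ltnn.
Qed.

(** Both sides have the same polar form, so their difference is additive; it
    vanishes at the multiples of the basis vectors. *)
Lemma quad_coords v : q v = qf (diag_row q) (polar_form q) (coords v).
Proof.
pose g v := q v - qf (diag_row q) (polar_form q) (coords v).
have gD u w : g (u + w) = g u + g w.
  rewrite /g coordsD qfD //; [|exact: polar_form_sym|exact: polar_form_diag].
  rewrite -polar_coords.
  have -> : q (u + w) = q u + q w + polar q u w by rewrite /polar; ring.
  ring.
have gZ c w : g (c *: w) = c ^+ 2 * g w.
  by rewrite /g quadZ coordsZ qfZ mulrBr.
have g0 : g 0 = 0 by have := gZ 0 0; rewrite scale0r expr0n mul0r.
apply/eqP; rewrite -subr_eq0 -/(g v) -(coordsK v) (big_morph g gD g0).
apply/eqP/big1 => i _; rewrite gZ /g.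
have -> : coords (tnth e i) = delta_mx 0 i.
  by apply/rowP => j; rewrite !mxE (tnth_nth 0) coord_free ?(basis_free he) // eqxx /= eq_sym.
by rewrite qf_delta [diag_row _ _ _]mxE subrr mulr0.
Qed.
End Form.

Section Map.
Variables (R : comNzRingType) (f : {rmorphism k -> R}) (q : E -> k).

Lemma map_qpoly : map_mpoly f (Defs.qpoly e q) =
  \sum_(i < n) f (q (tnth e i)) *: 'X_i ^+ 2 +
  \sum_(i < n) \sum_(j < n | (i < j)%N)
     f (polar q (tnth e i) (tnth e j)) *: ('X_i * 'X_j).
Proof.
rewrite /qpoly rmorphD !rmorph_sum /=; congr (_ + _); apply: eq_bigr => i _.
  by rewrite map_mpolyZ rmorphXn /= map_mpolyX.
rewrite rmorph_sum; apply: eq_bigr => j _.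
by rewrite /= map_mpolyZ rmorphM /= !map_mpolyX.
Qed.

Lemma meval_qpoly v : (map_mpoly f (Defs.qpoly e q)).@[v] =
  qf (map_mx f (diag_row q)) (map_mx f (polar_form q)) (\row_i v i).
Proof.
rewrite map_qpoly mevalD !rmorph_sum /qf /=; congr (_ + _); apply: eq_bigr => i _.
  by rewrite mevalZ rmorphXn /= mevalXU !mxE.
rewrite rmorph_sum; apply: eq_bigr => j _.
by rewrite /= mevalZ mevalM !mevalXU !mxE.
Qed.

(** The squares have derivative zero; by [bil_triangular] the other terms give the
    polar form paired with the j-th basis vector. *)
Lemma mderiv_qpoly v j : quadratic_form q ->
  ((map_mpoly f (Defs.qpoly e q))^`M(j)).@[v] =
  ((\row_i v i) *m map_mx f (polar_form q)) 0 j.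
Proof.
move=> hq.
have X i : (('X_i : {mpoly R[n]})^`M(j)).@[v] = (delta_mx 0 j : 'rV[R]_n) 0 i.
  rewrite mderivX mevalZ mnm1E mxE eqxx /=; have [->|] := eqVneq i j; last by rewrite mul0r.
  rewrite (_ : (U_(j) - U_(j))%MM = 0%MM) ?mpolyX0 ?meval1 ?mulr1 //.
  by apply/mnmP => l; rewrite mnmBE mnm0E subnn.
have hR : 2%N \in [pchar R] by exact: (rmorph_pchar f hk).
pose mderiv_sum := big_morph (mderiv j) (mderivD j) (@mderiv0 n R j).
rewrite map_qpoly mderivD mevalD !mderiv_sum !rmorph_sum /=.
rewrite big1 => [|i _]; last first.
  by rewrite mderivZ mevalZ mderivM mevalD !mevalM [X in _ + X]mulrC (addrr_pchar2 hR) mulr0.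
rewrite add0r.
transitivity (bil (map_mx f (polar_form q)) (\row_i v i) (delta_mx 0 j)); last first.
  by rewrite /bil trmx_delta -colE mxE.
rewrite bil_triangular; first last.
- by move=> i; rewrite mxE polar_form_diag ?rmorph0.
- by rewrite map_trmx polar_form_sym.
apply: eq_bigr => i _; rewrite mderiv_sum rmorph_sum; apply: eq_bigr => l _.
rewrite /= mderivZ mevalZ mderivM mevalD !mevalM !X !mevalXU [RHS]mulrC ![(\row_i v i) _ _]mxE.
by rewrite [map_mx _ _ _ _]mxE [polar_form _ _ _]mxE; ring.
Qed.
End Map.

End Coordinates.

(** * The coefficients of the half-discriminant *)
Lemma mnm2_eq a b c d :
  ((U_(ord0 : 'I_2) *+ a + U_(ord_max) *+ b)%MM == (U_(ord0) *+ c + U_(ord_max) *+ d)%MM) =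
  (a == c) && (b == d).
Proof.
apply/eqP/andP => [/mnmP mE|[/eqP-> /eqP->] //].
have := mE ord0; have := mE ord_max.
by rewrite !mnmDE !mulmnE !mnm1E !eqxx /= !mul1n !mul0n !add0n !addn0 => -> ->.
Qed.

Section Transfer.
Variables (k : fieldType) (hk : 2%N \in [pchar k]) (m : nat) (E : vectType k).
Notation n := (m.*2.+1).
Variables (e : n.-tuple E) (he : basis_of fullv e).
Variables (q0 q1 : E -> k) (hq0 : quadratic_form q0) (hq1 : quadratic_form q1).
Hypothesis hreg : regular_pair e q0 q1.

Notation d0 := (diag_row e q0). Notation d1 := (diag_row e q1).
Notation A0 := (polar_form e q0). Notation A1 := (polar_form e q1).

Lemma regular_pair_forms : regular_forms d0 d1 A0 A1.
Proof.
move=> K f v v0 qv0 qv1 t0 t1 vt.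
have vrow : \row_i v 0 i = v by apply/rowP => i; rewrite mxE.
have := @hreg K f (fun i => v 0 i); cbv zeta; rewrite !meval_qpoly vrow => rk.
set J := jacobian _ _ in rk; have {rk} Jrk : \rank J = 2%N.
  by apply: rk => //; have /rV0Pn[i vi] := v0; exists i.
have JE : J = col_mx (v *m map_mx f A0) (v *m map_mx f A1) :> 'M_(1 + 1, n).
  apply/matrixP => i j; rewrite mxE (tnth_nth 0) [RHS]mxE.
  case: splitP => i' ->; rewrite ord1 /= (mderiv_qpoly hk) ?vrow //.
have Jfree : row_free (J : 'M_(1 + 1, n)) by rewrite /row_free Jrk.
have : row_mx (t0%:M : 'M_1) t1%:M *m (J : 'M_(1 + 1, n)) = 0.
  by rewrite JE mul_row_col !mul_scalar_mx.
move/eqP; rewrite mulmx_free_eq0 // -row_mx0 => /eqP/eq_row_mx.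
case=> /matrixP/(_ 0 0) + /matrixP/(_ 0 0).
by rewrite !mxE.
Qed.

Let AC0 : A0^T = A0. Proof. exact: polar_form_sym. Qed.
Let AC1 : A1^T = A1. Proof. exact: polar_form_sym. Qed.
Let Axx0 i : A0 i i = 0. Proof. exact: polar_form_diag. Qed.
Let Axx1 i : A1 i i = 0. Proof. exact: polar_form_diag. Qed.

Notation kv := (kernel_coef A0 A1).

(** The Pfaffian vector of the pencil is \sum_h t_0^(m-h) t_1^h w_h by
    [pfaffian_seq_pencil], and the forms are diagonal on the isotropic space W. *)
Lemma half_disc_pencil (R : comNzRingType) (f : {rmorphism k -> R}) (t0 t1 : R) :
  half_disc (t0 *: map_mpoly f (Defs.qpoly e q0) + t1 *: map_mpoly f (Defs.qpoly e q1)) =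
  \sum_(h < m.+1) (t0 * f (qf d0 A0 (kv h)) + t1 * f (qf d1 A1 (kv h))) *
     (t0 ^+ (m - h) * t1 ^+ h) ^+ 2.
Proof.
rewrite /half_disc; set F := _ + _.
have hR : 2%N \in [pchar R] by exact: (rmorph_pchar f hk).
have FE v : F.@[v] = t0 * qf (map_mx f d0) (map_mx f A0) (\row_i v i) +
    t1 * qf (map_mx f d1) (map_mx f A1) (\row_i v i).
  by rewrite /F mevalD !mevalZ !meval_qpoly.
have fAC (B : 'M[k]_n) : B^T = B -> (map_mx f B)^T = map_mx f B by move=> BC; rewrite map_trmx BC.
have fAxx (B : 'M[k]_n) : (forall i, B i i = 0) -> forall i, map_mx f B i i = 0.
  by move=> B0 i; rewrite mxE B0 rmorph0.
have PE i j : polar_mx F i j = t0 * f (A0 i j) + t1 * f (A1 i j).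
  have rowE (v : 'rV[R]_n) : \row_i v ord0 i = v :> 'rV[R]_n by apply/rowP => l; rewrite mxE.
  have pE d (B : 'M[k]_n) : B^T = B -> (forall i, B i i = 0) ->
      qf d (map_mx f B) (delta_mx 0 i + delta_mx 0 j) =
      qf d (map_mx f B) (delta_mx 0 i) + qf d (map_mx f B) (delta_mx 0 j) + f (B i j).
    move=> BC Bxx; rewrite qfD ?fAC //; last exact: fAxx.
    by rewrite /bil trmx_delta -matrix.rowE -colE !mxE.
  rewrite mxE /polar !FE !rowE !pE //; ring.
pose z : 'rV[R]_m.+1 := \row_h (t0 ^+ (m - h) * t1 ^+ h).
have -> : F.@[fun i => pfaffian (row' i (col' i (polar_mx F)))] =
   F.@[fun i => (z *m map_mx f (kernel_mx A0 A1)) 0 i].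
  apply: meval_eq => i; rewrite pfaffian_minor //; last first.
    by move=> x y; rewrite !PE -{1}AC0 -{1}AC1 ![_^T _ _]mxE.
  transitivity (pfaffian_vector (fun x y => t0 * f (A0 x y) + t1 * f (A1 x y)) i).
    exact: eq_pfaffian_seq.
  rewrite /pfaffian_vector pfaffian_seq_pencil /homogenize mxE; apply: eq_bigr => h _.
  by rewrite !mxE mulrC.
rewrite FE.
have -> : \row_i (z *m map_mx f (kernel_mx A0 A1)) 0 i = z *m map_mx f (kernel_mx A0 A1).
  by apply/rowP => i; rewrite mxE.
have [W0 W1] := kernel_mx_iso hk AC0 Axx0 AC1 Axx1.
rewrite !qf_mul ?fAC //; try exact: fAxx; try by rewrite map_trmx -!map_mxM (W0, W1) map_mx0.
rewrite !mulr_sumr -big_split; apply: eq_bigr => h _ /=.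
by rewrite -!map_row !qf_map rowK mxE; ring.
Qed.

Lemma Delta_expand : Delta e q0 q1 =
  \sum_(h < m.+1)
    ((qf d0 A0 (kv h))%:MP * 'X_[U_(ord0) *+ (m - h).*2.+1 + U_(ord_max) *+ h.*2] +
     (qf d1 A1 (kv h))%:MP * 'X_[U_(ord0) *+ (m - h).*2 + U_(ord_max) *+ h.*2.+1]).
Proof.
have sq (R : comNzRingType) (x y a b : R) p q :
    (x * a + y * b) * (x ^+ p * y ^+ q) ^+ 2 =
    a * (x ^+ p.*2.+1 * y ^+ q.*2) + b * (x ^+ p.*2 * y ^+ q.*2.+1).
  by rewrite !exprS -!muln2 !exprM; ring.
rewrite /Delta half_disc_pencil; apply: eq_bigr => h _.
by rewrite !mpolyXD -!mpolyXn -sq.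
Qed.

Lemma Delta_coefE i : Delta_coef e q0 q1 i =
  \sum_(h < m.+1) (qf d0 A0 (kv h) * (((m - h).*2.+1 == n - i)%N && (h.*2 == i))%:R +
    qf d1 A1 (kv h) * (((m - h).*2 == n - i)%N && (h.*2.+1 == i))%:R).
Proof.
rewrite /Delta_coef Delta_expand (big_morph (mcoeff _) (mcoeffD _) (mcoeff0 _ _)).
by apply: eq_bigr => h _; rewrite mcoeffD !mcoeffCM !mcoeffX !mnm2_eq.
Qed.

Lemma Delta_coef_even i : (i <= m)%N -> Delta_coef e q0 q1 i.*2 = qf d0 A0 (kv i).
Proof.
move=> im; rewrite Delta_coefE (bigD1 (Ordinal (im : (i < m.+1)%N))) //= big1 ?addr0 => [|h hi].
  have -> : ((m - i).*2.+1 == m.*2.+1 - i.*2)%N by lia.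
  have -> : (i.*2.+1 == i.*2)%N = false by lia.
  by rewrite eqxx andbF mulr0 mulr1 addr0.
have {}hi : (h == i :> nat) = false by apply: negbTE.
have -> : (h.*2 == i.*2)%N = false by lia.
have -> : (h.*2.+1 == i.*2)%N = false by lia.
by rewrite !andbF !mulr0 addr0.
Qed.

Lemma Delta_coef_odd i : (i <= m)%N -> Delta_coef e q0 q1 i.*2.+1 = qf d1 A1 (kv i).
Proof.
move=> im; rewrite Delta_coefE (bigD1 (Ordinal (im : (i < m.+1)%N))) //= big1 ?addr0 => [|h hi].
  have -> : ((m - i).*2 == m.*2.+1 - i.*2.+1)%N by lia.
  have -> : (i.*2 == i.*2.+1)%N = false by lia.
  by rewrite eqxx andbF mulr0 mulr1 add0r.
have {}hi : (h == i :> nat) = false by apply: negbTE.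
have -> : (h.*2 == i.*2.+1)%N = false by lia.
have -> : (h.*2.+1 == i.*2.+1)%N = false by lia.
by rewrite !andbF !mulr0 addr0.
Qed.

End Transfer.

(** * Generators and normal forms *)
Section Functionals.
Variables (k : fieldType) (E : vectType k) (n : nat) (e : n.-tuple E) (he : basis_of fullv e).

Definition functional (c : 'cV[k]_n) : 'Hom(E, k^o) :=
  \sum_i c i 0 *: linfun (coord e i : E -> k^o).

Lemma functionalE c v : functional c v = (coords e v *m c) 0 0.
Proof.
rewrite sum_lfunE mxE; apply: eq_bigr => i _.
by rewrite scale_lfunE lfunE /= mxE mulrC.
Qed.

Lemma functionals_basis p r (X : 'M[k]_(n, p)) (Y : 'M[k]_(n, r)) :
  \dim {:E} = n -> (p + r)%N = n ->
  (forall (c : 'cV_p) (d : 'cV_r), X *m c + Y *m d = 0 -> c = 0 /\ d = 0) ->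
  basis_of fullv ([tuple functional (col i X) | i < p] ++
                  [tuple functional (col i Y) | i < r]).
Proof.
move=> dE pr XY; set b := _ ++ _.
have sb : size b == (p + r)%N by rewrite size_cat !size_tuple.
have bl (i : 'I_p) : b`_(lshift r i) = functional (col i X).
  by rewrite nth_cat size_tuple [X in if X then _ else _](ltn_ord i) -tnth_nth tnth_mktuple.
have br (i : 'I_r) : b`_(rshift p i) = functional (col i Y).
  rewrite nth_cat size_tuple [X in if X then _ else _]ltnNge leq_addr addKn.
  by rewrite -tnth_nth tnth_mktuple.
have ej j : coords e (tnth e j) = delta_mx 0 j.
  by apply/rowP => i; rewrite !mxE (tnth_nth 0) coord_free ?(basis_free he) // eqxx /= eq_sym.
have fe c j : functional c (tnth e j) = c j 0.
  by rewrite functionalE ej -rowE mxE.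
have bfree : free (Tuple sb).
  apply/freeP => c; rewrite big_split_ord /= => c0.
  have [|c1 c2] := XY (\col_i c (lshift r i)) (\col_i c (rshift p i)).
    apply/colP => j; rewrite [RHS]mxE.
    have := congr1 (fun g : 'Hom(E, k^o) => g (tnth e j)) c0.
    rewrite zero_lfunE => <-; rewrite add_lfunE !sum_lfunE mxE; congr (_ + _).
      by rewrite mxE; apply: eq_bigr => i _; rewrite bl scale_lfunE fe !mxE mulrC.
    by rewrite mxE; apply: eq_bigr => i _; rewrite br scale_lfunE fe !mxE mulrC.
  move=> i; case: (splitP i) => j ij.
    have -> : i = lshift r j by apply/val_inj.
    by have /colP/(_ j) := c1; rewrite !mxE.
  have -> : i = rshift p j by apply/val_inj.
  by have /colP/(_ j) := c2; rewrite !mxE.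
rewrite basisEfree [free b]bfree subvf /= (eqP sb) pr -dE !dimvf.
have -> : dim 'Hom(E, k^o) = (dim E * 1)%N by reflexivity.
by rewrite muln1.
Qed.
End Functionals.

Section Generators.
Variables (k : fieldType) (hk : 2%N \in [pchar k]) (m : nat) (E : vectType k).
Notation n := (m.*2.+1).
Variables (e : n.-tuple E) (he : basis_of fullv e).
Variables (q0 q1 : E -> k) (hq0 : quadratic_form q0) (hq1 : quadratic_form q1).

Notation d0 := (diag_row e q0). Notation d1 := (diag_row e q1).
Notation A0 := (polar_form e q0). Notation A1 := (polar_form e q1).

Lemma quasi_split_generator : quasi_split m q0 q1 ->
  exists L : 'M[k]_(m, n),
    [/\ row_free L, totally_singular d0 A0 L & totally_singular d1 A1 L].
Proof.
case=> L [dimL Lq].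
have [b [bL bfree]] : exists b : m.-tuple E, (forall i, tnth b i \in L) /\ free b.
  rewrite -dimL; exists (vbasis L); split; last exact: basis_free (vbasisP L).
  by move=> i; apply: vbasis_mem; apply: mem_tnth.
pose M := \matrix_(i < m) coords e (tnth b i); exists M.
have ts q : quadratic_form q -> (forall v, v \in L -> q v = 0) ->
    totally_singular (diag_row e q) (polar_form e q) M.
  move=> hq q_0; split=> [|i]; last by rewrite rowK -(quad_coords hk he hq) q_0.
  apply/matrixP => i j; rewrite [RHS]mxE.
  have -> : (M *m polar_form e q *m M^T) i j = bil (polar_form e q) (row i M) (row j M).
    by rewrite /bil -row_mul !mxE; apply: eq_bigr => l _; rewrite !mxE.
  rewrite !rowK -(polar_coords he hq) /polar !q_0 ?subrr ?subr0 //.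
  by rewrite rpredD.
split; [|by apply: ts => // v /Lq[]|by apply: ts => // v /Lq[]].
apply: row_free_injP => z; rewrite mulmx_sum_row => zM.
have : \sum_i z 0 i *: tnth b i = 0.
  rewrite -[LHS](coordsK he) -[RHS](coordsK he); congr vect.
  have c0 : coords e 0 = 0 by apply/rowP => j; rewrite !mxE linear0.
  rewrite c0 -[RHS]zM (big_morph _ (coordsD e) c0); apply: eq_bigr => i _.
  by rewrite coordsZ rowK.
under eq_bigr => i _ do rewrite (tnth_nth 0).
by move/freeP: bfree => bfree /bfree z0; apply/rowP => i; rewrite z0 mxE.
Qed.

(** The vectors on which all the x_i vanish form a space of dimension at least
    n - (m+1) = m, on which q_0 and q_1 vanish. *)
Lemma split_normal_form_quasi_split :
  has_split_normal_form e q0 q1 -> quasi_split m q0 q1.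
Proof.
case=> x [y [r [[_ q0E q1E] r0]]].
pose M : 'M[k]_(n, m.+1) := \matrix_(j, i) x`_i (tnth e j).
have [|C /andP[Cfree CM]] := @submx_of_rank k _ _ m (kermx M).
  by rewrite mxrank_ker; have := rank_leq_col M; lia.
pose b := [tuple vect e (row i C) | i < m].
have bE (i : 'I_m) : b`_i = vect e (row i C) by rewrite -tnth_nth tnth_mktuple.
have xb (i : 'I_m.+1) (j : 'I_m) : x`_i b`_j = 0.
  rewrite bE /vect linear_sum /=.
  transitivity ((row j C *m M) 0 i).
    by rewrite mxE; apply: eq_bigr => l _; rewrite linearZ [M _ _]mxE.
  by rewrite -row_mul (sub_kermxP CM) !mxE.
have bfree : free b.
  apply/freeP => c c0; suff z0 : \row_i c i = 0.
    by move=> i; have /rowP/(_ i) := z0; rewrite !mxE.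
  apply/eqP; rewrite -(mulmx_free_eq0 _ Cfree) mulmx_sum_row; apply/eqP.
  have v0 : vect e 0 = 0 by rewrite /vect big1 // => i _; rewrite mxE scale0r.
  rewrite -[LHS](vectK he) -[RHS](vectK he); congr coords; rewrite v0 -[RHS]c0.
  have vD u w : vect e (u + w) = vect e u + vect e w.
    by rewrite /vect -big_split; apply: eq_bigr => i _; rewrite mxE scalerDl.
  rewrite (big_morph _ vD v0); apply: eq_bigr => i _.
  rewrite bE /vect scaler_sumr; apply: eq_bigr => l _.
  by rewrite !mxE scalerA.
exists <<b>>%VS; split; first by have := eqP bfree; rewrite size_tuple.
move=> v /coord_span vE.
have xv i : (i < m.+1)%N -> x`_i v = 0.
  move=> im; rewrite vE linear_sum big1 // => j _ /=.
  by rewrite linearZ /= (xb (Ordinal im)) scaler0.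
rewrite q0E q1E; split.
  rewrite !big1 ?addr0 // => i _.
  - by rewrite r0 ?mul0r //; have := ltn_ord i; lia.
  - by rewrite xv ?mul0r // ltnS.
  - by rewrite xv // expr0n mulr0.
rewrite !big1 ?addr0 // => i _.
- by rewrite r0 ?mul0r //; have := ltn_ord i; lia.
- by rewrite xv ?mul0r // ltnS ltnW.
- by rewrite xv // expr0n mulr0.
Qed.
End Generators.

Section Final.
Variables (k : fieldType) (hk : 2%N \in [pchar k]) (m : nat) (E : vectType k).
Notation n := (m.*2.+1).
Variables (e : n.-tuple E) (he : basis_of fullv e).
Variables (q0 q1 : E -> k) (hq0 : quadratic_form q0) (hq1 : quadratic_form q1).
Hypothesis hreg : regular_pair e q0 q1.
Hypothesis m0 : (0 < m)%N.
Hypothesis hE : \dim {:E} = n.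

Notation d0 := (diag_row e q0). Notation d1 := (diag_row e q1).
Notation A0 := (polar_form e q0). Notation A1 := (polar_form e q1).

Let AC0 : A0^T = A0. Proof. exact: polar_form_sym. Qed.
Let AC1 : A1^T = A1. Proof. exact: polar_form_sym. Qed.
Let Axx0 i : A0 i i = 0. Proof. exact: polar_form_diag. Qed.
Let Axx1 i : A1 i i = 0. Proof. exact: polar_form_diag. Qed.
Let reg : regular_forms d0 d1 A0 A1.
Proof. exact: regular_pair_forms. Qed.

(** The functionals form a basis: a relation between the columns of X and the
    y_i is killed by evaluating at the w_i, where X is the identity and the y_i
    vanish, and then by the independence of the y_i. *)
Lemma generator_split_normal_form (L : 'M[k]_(m, n)) : row_free L ->
  totally_singular d0 A0 L -> totally_singular d1 A1 L ->
  has_split_normal_form e q0 q1.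
Proof.
move=> Lfree L0 L1.
have [X [WX q0E q1E]] := generator_coords hk AC0 Axx0 AC1 Axx1 reg m0 Lfree L0 L1.
set Y := pairing_mx A0 A1 in q0E q1E.
pose x := [tuple functional e (col i X) | i < m.+1].
pose y := [tuple functional e (col i Y^T) | i < m].
pose r : (m.*2).-tuple k := nseq_tuple m.*2 0.
have r0 i : r`_i = 0 by rewrite nth_nseq if_same.
have colE p (M : 'M_(n, p)) i v : functional e (col i M) v = (coords e v *m M) 0 i.
  by rewrite functionalE !mxE; apply: eq_bigr => j _; rewrite [col _ _ _ _]mxE.
have xE (i : 'I_m.+1) v : x`_i v = (coords e v *m X) 0 i.
  by rewrite -tnth_nth tnth_mktuple colE.
have yE (i : 'I_m) v : y`_i v = (coords e v *m Y^T) 0 i.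
  by rewrite -tnth_nth tnth_mktuple colE.
exists x, y, r; split; last by [].
split.
- apply: (functionals_basis he) => //; first by lia.
  move=> c d cd.
  have WY : kernel_mx A0 A1 *m Y^T = 0.
    by rewrite -[LHS]trmxK trmx_mul trmxK pairing_kernel_mx // trmx0.
  have c0 : c = 0.
    have := congr1 (mulmx (kernel_mx A0 A1)) cd.
    by rewrite mulmx0 mulmxDr !mulmxA WX WY mul0mx addr0 mul1mx.
  split=> //; move: cd; rewrite c0 mulmx0 add0r => /(congr1 trmx).
  rewrite trmx_mul trmxK trmx0 => /eqP.
  rewrite mulmx_free_eq0 ?(pairing_mx_free hk AC0 Axx0 AC1 Axx1 reg m0) //.
  by move/eqP/(congr1 trmx); rewrite trmxK trmx0.
- move=> v; rewrite (quad_coords hk he hq0) q0E.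
  rewrite [X in _ = _ + X]big1 ?addr0 => [|i _]; last by rewrite r0 mul0r.
  congr (_ + _); apply: eq_bigr => i _.
    by rewrite (Delta_coef_even hk) ?leq_ord // xE.
  by rewrite yE -[x`_i.+1]/(x`_(lift ord0 i)) xE.
- move=> v; rewrite (quad_coords hk he hq1) q1E.
  rewrite [X in _ = _ + X]big1 ?addr0 => [|i _]; last by rewrite r0 mul0r.
  congr (_ + _); apply: eq_bigr => i _.
    by rewrite (Delta_coef_odd hk) ?leq_ord // xE.
  by rewrite yE -[x`_i]/(x`_(widen_ord (leqnSn m) i)) xE.
Qed.
End Final.

Theorem theorem1p3 (k : fieldType) (hk : 2%N \in [pchar k])
    (m : nat) (hm : (3 <= m.*2.+1)%N)
    (E : vectType k) (hE : \dim {:E} = m.*2.+1)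
    (vol : (m.*2.+1).-tuple E -> k) (hvol : volume_form vol)
    (e : (m.*2.+1).-tuple E) (he : basis_of fullv e) (hvole : vol e = 1)
    (q0 q1 : E -> k) (hq0 : quadratic_form q0) (hq1 : quadratic_form q1)
    (hreg : regular_pair e q0 q1) :
  (quasi_split m q0 q1 <-> has_split_normal_form e q0 q1) /\
  (GRing.closed_field_axiom k -> has_split_normal_form e q0 q1).
Proof.
have m0 : (0 < m)%N by lia.
split; first split.
- move=> /(quasi_split_generator hk he hq0 hq1)[L [Lfree L0 L1]].
  exact: (generator_split_normal_form hk he hq0 hq1 hreg m0 hE Lfree L0 L1).
- exact: split_normal_form_quasi_split.
move=> closedk.
have [] := @closed_generator k hk m closedk (diag_row e q0) (diag_row e q1)
  (polar_form e q0) (polar_form e q1).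
- exact: polar_form_sym.
- exact: polar_form_diag.
- exact: polar_form_sym.
- exact: polar_form_diag.
- exact: regular_pair_forms.
- exact: m0.
move=> L [Lfree L0 L1].
exact: (generator_split_normal_form hk he hq0 hq1 hreg m0 hE Lfree L0 L1).
Qed.
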